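(* Let $\mathfrak{H}=(V,\langle\cdot,\cdot\rangle,J,A)$ be a complex Osserman Kähler model of dimension $n=\dim_{\mathbb{R}}V\ge 4$ which is not flat (i.e. $A\neq 0$). Then one of the following holds: (1) $\mathfrak{H}$ has exactly 2 distinct eigenvalues, of multiplicities $(n-2,2)$. (2) $\mathfrak{H}$ has exactly 3 distinct eigenvalues, of multiplicities $(n-4,2,2)$, and $n=4k\ge 8$ for some integer $k$.
   Context: An algebraic curvature tensor on a finite-dimensional real vector space $V$ is $A\in\otimes^4V^*$ with $A(x,y,z,w)=-A(y,x,z,w)=A(z,w,x,y)$ and $A(x,y,z,w)+A(y,z,x,w)+A(z,x,y,w)=0$. An almost-Hermitian curvature model is $\mathfrak{H}=(V,\langle\cdot,\cdot\rangle,J,A)$ with $\langle\cdot,\cdot\rangle$ a positive definite inner product, $J$ an endomorphism with $J^2=-\mathrm{Id}$ and $\langle Jx,Jy\rangle=\langle x,y\rangle$, and $A$ an algebraic curvature tensor. The curvature operator $A(x,y)$ is defined by $\langle A(x,y)z,w\rangle=A(x,y,z,w)$; the Jacobi operator is $\mathcal{J}(x):y\mapsto A(y,x)x$. A complex line is a $2$-dimensional real subspace $\pi$ with $J\pi=\pi$; for a unit vector $x$, $\pi_x=\mathrm{Span}\{x,Jx\}$, and $\mathbb{CP}(\mathfrak{H})$ is the set of complex lines. The complex Jacobi operator is $\mathcal{J}(\pi):=\mathcal{J}(x)+\mathcal{J}(Jx)$ for any unit $x\in\pi$. $\mathfrak{H}$ is a Kähler model if $A(Jx,Jy)=A(x,y)$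 for all $x,y$. $\mathfrak{H}$ is complex Osserman if $J\mathcal{J}(\pi)=\mathcal{J}(\pi)J$ for every complex line $\pi$ and the eigenvalues (with multiplicities) of $\mathcal{J}(\pi)$ do not depend on $\pi\in\mathbb{CP}(\mathfrak{H})$; these are then called the eigenvalues and (real) multiplicities of $\mathfrak{H}$. *)

(* Defs.v *)
From HB Require Import structures.
From mathcomp Require Import all_boot all_order all_algebra.
From mathcomp Require Import reals ring.

Set Implicit Arguments.
Unset Strict Implicit.
Unset Printing Implicit Defensive.

Import passmx.
Import Order.TTheory GRing.Theory Num.Theory.
Local Open Scope ring_scope.

Record is_curvature_tensor (R : realType) (V : vectType R)
    (A : V -> V -> V -> V -> R) : Prop := IsCurvatureTensor {
  curv_linear1 : forall y z w, scalar (fun x => A x y z w);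
  curv_linear2 : forall x z w, scalar (fun y => A x y z w);
  curv_linear3 : forall x y w, scalar (fun z => A x y z w);
  curv_linear4 : forall x y z, scalar (fun w => A x y z w);
  curv_antisym : forall x y z w, A x y z w = - A y x z w;
  curv_pairsym : forall x y z w, A x y z w = A z w x y;
  curv_bianchi : forall x y z w, A x y z w + A y z x w + A z x y w = 0
}.

Record hermitian_model (R : realType) (V : vectType R) := HermitianModel {
  ip : {dot V for @idfun R};
  cplx : 'End(V);
  curv : V -> V -> V -> V -> R;
  cplx_sqr : (cplx \o cplx)%VF = - \1%VF;
  cplx_isometry : forall x y, ip (cplx x) (cplx y) = ip x y;
  curv_tensor : is_curvature_tensor curv
}.

Lemma linfunE_linear (R : realType) (U W : vectType R) (f : U -> W) :
  linear f -> linfun f =1 f.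
Proof.
move=> f_lin u.
pose fl : {linear U -> W} := HB.pack f (GRing.isLinear.Build _ _ _ _ f f_lin).
exact: (lfunE fl).
Qed.

Lemma scalar_comb (R : realType) (V : vectType R) (f : V -> R) :
  scalar f -> forall c d v v', f (c *: v + d *: v') = c * f v + d * f v'.
Proof.
move=> f_lin c d v v'.
have f0 : f 0 = 0.
  have := f_lin 1 0 0; rewrite scaler0 addr0 /= mul1r => /eqP.
  by rewrite -subr_eq0 opprD addrA subrr add0r oppr_eq0 => /eqP.
by rewrite f_lin; have := f_lin d v' 0; rewrite !addr0 f0 addr0 => ->.
Qed.

Section Model.
Variables (R : realType) (V : vectType R) (H : hermitian_model V).

Local Notation "''[' x , y ]" := (ip H x%R y%R) : ring_scope.
Local Notation J := (cplx H).
Local Notation A := (curv H).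

Definition ip_flat : 'Hom(V, 'Hom(V, R^o)) :=
  linfun (fun v => linfun (ip H v : V -> R^o)).

(* The vector representing a linear functional: ip_flat is invertible, by positive
   definiteness and equality of dimensions. *)
Definition ip_sharp (phi : 'Hom(V, R^o)) : V := (ip_flat^-1)%VF phi.

(* Characterized by curv_opP. *)
Definition curv_op (x y : V) : 'End(V) :=
  linfun (fun z => ip_sharp (linfun (A x y z : V -> R^o))).

Definition jacobi (x : V) : 'End(V) := linfun (fun y => curv_op y x x).

Definition unit_vector (x : V) : Prop := '[x, x] = 1.

Definition complex_line (pi : {vspace V}) : Prop :=
  \dim pi = 2 /\ (J @: pi)%VS = pi.

(* vpick picks a nonzero vector of a nonzero subspace. *)
Definition pick_unit (pi : {vspace V}) : V :=
  let v := vpick pi in (Num.sqrt '[v, v])^-1 *: v.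

(* The choice of the unit vector is irrelevant on complex lines, see
   complex_jacobiE. *)
Definition complex_jacobi (pi : {vspace V}) : 'End(V) :=
  let x := pick_unit pi in jacobi x + jacobi (J x).

Definition kahler : Prop := forall x y, curv_op (J x) (J y) = curv_op x y.

Definition is_flat : Prop := forall x y z w, A x y z w = 0.

(* Since complex_jacobi pi is self-adjoint (complex_jacobi_selfadj), the
   multiplicity of an eigenvalue is the dimension of its eigenspace. *)
Definition complex_osserman : Prop :=
  (forall pi, complex_line pi ->
     (J \o complex_jacobi pi)%VF = (complex_jacobi pi \o J)%VF) /\
  (forall pi pi', complex_line pi -> complex_line pi' -> forall a : R,
     \dim (leigenspace (complex_jacobi pi) a) =
     \dim (leigenspace (complex_jacobi pi') a)).

(* The model has exactly size ms distinct eigenvalues, with multiplicities ms. *)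
Definition has_multiplicities (ms : seq nat) : Prop :=
  exists2 eigs : seq R, uniq eigs &
    forall pi, complex_line pi ->
      (forall a, leigenvalue (complex_jacobi pi) a = (a \in eigs)) /\
      [seq \dim (leigenspace (complex_jacobi pi) a) | a <- eigs] = ms.

Lemma ipC x y : '[x, y] = '[y, x].
Proof. by rewrite (hermC (ip H)) /= expr0 mul1r. Qed.

Lemma ip_flatE x y : ip_flat x y = '[x, y].
Proof.
have ipE u : linfun (ip H u : V -> R^o) =1 ip H u by move=> v; rewrite lfunE.
rewrite /ip_flat linfunE_linear ?ipE // => a u v.
by apply/lfunP=> z; rewrite add_lfunE scale_lfunE !ipE linearPl.
Qed.

Lemma ip_eq0 x : '[x, x] = 0 -> x = 0.
Proof.
move=> xx; apply/eqP; apply: contraT => /(neq0_dnorm_gt0 (s := ip H)).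
by rewrite xx ltxx.
Qed.

Lemma ip_inj x y : (forall z, '[x, z] = '[y, z]) -> x = y.
Proof.
move=> xy; apply/eqP; rewrite -subr_eq0; apply/eqP/ip_eq0.
by rewrite linearBl /= xy subrr.
Qed.

Lemma ip_sharpP (phi : 'Hom(V, R^o)) z : '[ip_sharp phi, z] = phi z.
Proof.
have k0 : lker ip_flat == 0%VS.
  by apply/lker0P=> x y xy; apply: ip_inj => t; rewrite -!ip_flatE xy.
have full : limg ip_flat = fullv.
  apply/eqP; rewrite eqEdim subvf limg_dim_eq ?(eqP k0) ?capv0 // !dimvf.
  by rewrite /dim /= muln1.
by rewrite -ip_flatE /ip_sharp limg_lfunVK // full memvf.
Qed.

Lemma curv_opP x y z w : '[curv_op x y z, w] = A x y z w.
Proof.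
have [_ _ A3 A4 _ _ _] := curv_tensor H.
have sE u v : '[ip_sharp (linfun (A x y u : V -> R^o)), v] = A x y u v.
  by rewrite ip_sharpP linfunE_linear //; exact: A4.
rewrite /curv_op linfunE_linear ?sE // => a u v.
apply: ip_inj => t.
by rewrite linearPl /= !sE (A3 x y t).
Qed.

Lemma jacobiE x y : jacobi x y = curv_op y x x.
Proof.
have [A1 _ _ _ _ _ _] := curv_tensor H.
rewrite /jacobi linfunE_linear // => a u v; apply: ip_inj => t.
by rewrite linearPl /= !curv_opP (A1 x x t).
Qed.

Lemma jacobi_selfadj x y z : '[jacobi x y, z] = '[y, jacobi x z].
Proof.
have [_ _ _ _ asym psym _] := curv_tensor H.
rewrite (ipC y) !jacobiE !curv_opP.
have E u v : A u x x v = - A v x u x by rewrite psym asym.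
by rewrite !E psym.
Qed.

Lemma complex_jacobi_selfadj pi y z :
  '[complex_jacobi pi y, z] = '[y, complex_jacobi pi z].
Proof.
by rewrite /complex_jacobi !add_lfunE linearDl linearDr /= !jacobi_selfadj.
Qed.

Lemma cplxK x : J (J x) = - x.
Proof. by have /lfunP/(_ x) := cplx_sqr H; rewrite !lfunE /= lfunE. Qed.

Lemma ip_cplx0 x : '[x, J x] = 0.
Proof.
have : '[x, J x] = - '[x, J x].
  by rewrite -{1}cplx_isometry cplxK linearNr /= ipC.
by move/eqP; rewrite -subr_eq0 opprK -mulr2n mulrn_eq0 /= => /eqP.
Qed.

Lemma cplx_neq0 x : x != 0 -> J x != 0.
Proof. by apply: contra_neq => Jx; rewrite -[x]opprK -(cplxK x) Jx linear0 oppr0. Qed.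

Lemma dim_cplx_span x : x != 0 -> \dim (<[x]> + <[J x]>)%VS = 2.
Proof.
move=> x0; rewrite dimv_disjoint_sum ?dim_vline ?x0 ?cplx_neq0 //.
apply/eqP; rewrite -subv0; apply/subvP=> v; rewrite memv_cap memv0.
case/andP=> /vlineP[a va] /vlineP[b vb]; apply/eqP/ip_eq0.
rewrite {1}va vb linearZl_LR /= linearZr_LR /= ip_cplx0.
by rewrite !mulr0.
Qed.

Lemma complex_line_span x : x != 0 -> complex_line (<[x]> + <[J x]>)%VS.
Proof.
move=> x0; split; first exact: dim_cplx_span.
rewrite limgD !limg_line cplxK addvC; congr (_ + _)%VS.
by apply/eqP; rewrite eqEsubv -!memvE memvN memv_line -[X in X \in _]opprK memvN memv_line.
Qed.

Lemma complex_lineP pi x : complex_line pi -> x \in pi -> x != 0 ->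
  pi = (<[x]> + <[J x]>)%VS.
Proof.
move=> [dpi Jpi] xpi x0; apply/eqP; rewrite eq_sym eqEdim dim_cplx_span //.
by rewrite dpi leqnn subv_add -!memvE xpi -Jpi memv_img.
Qed.

Lemma pick_unitP pi : complex_line pi ->
  pick_unit pi \in pi /\ unit_vector (pick_unit pi).
Proof.
move=> [dpi _]; have v0 : vpick pi != 0 by rewrite vpick0 -dimv_eq0 dpi.
rewrite memvZ ?memv_pick //; split=> //.
have vv : 0 < '[vpick pi, vpick pi] := neq0_dnorm_gt0 (s := ip H) _ v0.
rewrite /unit_vector /pick_unit linearZl_LR /= linearZr_LR /=.
rewrite mulrA -expr2 exprVn sqr_sqrtr ?ltW // mulVf //.
by rewrite gt_eqF.
Qed.

Lemma complex_jacobiE pi x : complex_line pi -> x \in pi -> unit_vector x ->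
  complex_jacobi pi = jacobi x + jacobi (J x).
Proof.
move=> pil xpi x1; have [upi u1] := pick_unitP pil.
rewrite /complex_jacobi; move: (pick_unit pi) upi u1 => u upi u1.
have x0 : x != 0.
  apply/eqP=> xE; move: x1; rewrite /unit_vector xE linear0l => /eqP.
  by rewrite eq_sym oner_eq0.
move: upi; rewrite (complex_lineP pil xpi x0).
case/memv_addP=> _ /vlineP[a ->] [_ /vlineP[b ->] uE].
have ab1 : a * a + b * b = 1.
  move: u1; rewrite /unit_vector uE linearDl !linearDr /= !linearZl_LR /=.
  rewrite !linearZr_LR /= cplx_isometry ip_cplx0 (ipC (J x)) ip_cplx0 x1.
  by rewrite !mulr0 !mulr1 addr0 add0r.
have JuE : J u = a *: J x - b *: x.
  by rewrite uE linearD !linearZ /= cplxK scalerN.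
have [_ A2 A3 _ _ _ _] := curv_tensor H.
apply/lfunP=> y; apply: ip_inj => t.
rewrite !add_lfunE !linearDl /= !jacobiE !curv_opP JuE uE -scaleNr.
have L2 p z w c d v v' :
    A p (c *: v + d *: v') z w = c * A p v z w + d * A p v' z w.
  by rewrite (scalar_comb (A2 p z w)).
have L3 p z w c d v v' :
    A p z (c *: v + d *: v') w = c * A p z v w + d * A p z v' w.
  by rewrite (scalar_comb (A3 p z w)).
rewrite !L2 !L3.
transitivity ((a * a + b * b) * (A y x x t + A y (J x) (J x) t)).
  ring.
by rewrite ab1 mul1r.
Qed.

End Model.

(* Main.v *)
Require Import Defs.
From mathcomp Require Import all_boot all_order all_algebra.
From mathcomp Require Import reals.
From mathcomp Require boolp classical_sets topology normedtype derive.
From mathcomp Require Import ring lra.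

(* With R(x, z) := A(x, z) + J A(x, J z), complex linear in x and antilinear in z,
   the Kahler symmetries make R(x, z) w symmetric in (x, w), the adjoint of
   R(x, z) is R(z, x), and the complex Jacobi operator of the line of x is
   T_x := R(x, x).  The isospectrality of T_x on the unit sphere is used
   through first and second order perturbation theory.

   To first order, w is in E_a(x) iff x is in E_a(w).  Let y maximize the
   holomorphic sectional curvature <T_y y, y>, with maximal value Lam; after a
   change of sign of A one may assume Lam > 0.  Then T_y y = Lam y, all other
   eigenvalues are at most Lam / 2, and Lam has multiplicity 2.  To second order
   at y, every eigenvalue a outside {Lam, Lam / 2, 0} has a partner b with
   1/a + 1/b = 2/Lam.  Comparing with the same relation at a minimum shows that
   all eigenvalues are nonnegative, hence that they lie in {Lam, Lam / 2, 0}.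

   Finally Lam / 2 and 0 are not both eigenvalues: for z in E_{Lam/2}(y) the
   second order identities give
     T_z z = Lam |z|^2 z - (2/Lam) R(y, z) B   with B := R(z, y) z in E_0(y),
   while the first order ones give |T_z z|^2 = Lam |z|^2 <T_z z, z>.  Together
   they force B = 0, and polarization in z contradicts the identity
   |R(y, z) w| = (Lam/2) |z| |w| valid for w in E_0(y).  So only the first of
   the two alternatives of the theorem occurs. *)

Set Implicit Arguments.
Unset Strict Implicit.
Unset Printing Implicit Defensive.

Import Order.TTheory GRing.Theory Num.Theory passmx.
Local Open Scope ring_scope.

(** * Extracting leading coefficients as t tends to 0 *)

Lemma le0_of_le_scale (R : realFieldType) (a K : R) :
  (forall t, 0 < t -> t <= 1 -> a <= t * K) -> a <= 0.
Proof.
move=> h; rewrite leNgt; apply/negP => a0.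
have D0 : 0 < a + `|K| by rewrite ltr_pwDl.
have := h (a / (a + `|K|)) (divr_gt0 a0 D0).
rewrite ler_pdivrMr // mul1r lerDl normr_ge0 => /(_ isT).
rewrite mulrAC ler_pdivlMr // ler_pM2l // => aK.
have := ler_norm K; move: a0 aK; lra.
Qed.

(** The right-hand side is O(t), so only the constant term survives as t tends to 0. The shape is
    the one that [kop_gap] produces along [y + t *: x] after division by a power of t. *)
Lemma eq0_of_small (R : realFieldType) (a b c p q r : R) :
  (forall t, 0 < t -> t <= 1 ->
     `|a + t * b + t ^+ 2 * c| <= t * (p + t * q + t ^+ 2 * r)) -> a = 0.
Proof.
move=> h; apply/eqP; rewrite -normr_le0.
apply: (@le0_of_le_scale _ _ (`|b| + `|c| + `|p| + `|q| + `|r|)) => t t0 t1.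
have t20 : 0 <= t ^+ 2 by rewrite sqr_ge0.
have t2t : t ^+ 2 <= t by rewrite expr2 ger_pMl.
have bound (u d : R) : 0 <= u -> u <= 1 -> u * d <= `|d|.
  move=> u0 u1; apply: (le_trans (ler_norm _)).
  by rewrite normrM (ger0_norm u0) ler_piMl.
have H := h t t0 t1.
have : `|a| <= `|a + t * b + t ^+ 2 * c| + (t * `|b| + t * `|c|).
  rewrite -[X in `|X|](addrK (t * b + t ^+ 2 * c)) addrA.
  apply: (le_trans (ler_normB _ _)); rewrite lerD2l.
  apply: (le_trans (ler_normD _ _)); rewrite !normrM (gtr0_norm t0) -expr2.
  by rewrite lerD2l ler_wpM2r.
have : t * (p + t * q + t ^+ 2 * r) <= t * (`|p| + `|q| + `|r|).
  by rewrite ler_pM2l // !lerD ?ler_norm // bound ?(ltW t0) ?(le_trans t2t).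
move: H; rewrite !mulrDr; lra.
Qed.

Lemma cubic_le0 (R : realFieldType) (a b c d : R) :
  (forall t, 0 < t -> a + t * b + t ^+ 2 * c + t ^+ 3 * d <= 0) -> a <= 0.
Proof.
move=> h; apply: (@le0_of_le_scale _ _ (`|b| + `|c| + `|d|)) => t t0 t1.
have bound (u e : R) : 0 <= u -> u <= t -> - (u * e) <= t * `|e|.
  move=> u0 ut; apply: (le_trans (ler_norm _)).
  by rewrite normrN normrM (ger0_norm u0) ler_wpM2r.
have t2 : t ^+ 2 <= t by rewrite expr2 ger_pMl.
have t3 : t ^+ 3 <= t by rewrite exprSr -[leRHS]mul1r ler_pM2r // expr_le1 // ltW.
have := bound t b (ltW t0) (lexx t); have := bound _ c (sqr_ge0 t) t2.
have := bound _ d (exprn_ge0 3 (ltW t0)) t3; have := h t t0.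
rewrite !mulrDr; lra.
Qed.

Lemma scalar_sum (R : realType) (V : vectType R) (f : V -> R) (f_lin : scalar f)
    (I : Type) (r : seq I) (c : I -> R) (b : I -> V) :
  f (\sum_(i <- r) c i *: b i) = \sum_(i <- r) c i * f (b i).
Proof.
elim: r => [|i r IH]; last first.
  by rewrite !big_cons f_lin /= IH.
by rewrite !big_nil; have := scalar_comb f_lin 0 0 0 0; rewrite !scale0r addr0 !mul0r addr0.
Qed.

(** * Spectral decomposition of self-adjoint operators *)

Section Compactness.
Import boolp classical_sets topology normedtype derive.
Import numFieldNormedType.Exports.
Local Open Scope classical_set_scope.
Local Open Scope ring_scope.

(* Quartic forms cover both the Rayleigh quotient of an operator (times <v, v>) and
   the holomorphic sectional curvature. *)
Lemma quartic_max (R : realType) (V : vectType R) (g : {dot V for @idfun R})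
    (F : V -> V -> V -> V -> R) (U : {vspace V}) :
  (forall y z w, scalar (fun x => F x y z w)) ->
  (forall x z w, scalar (fun y => F x y z w)) ->
  (forall x y w, scalar (fun z => F x y z w)) ->
  (forall x y z, scalar (fun w => F x y z w)) ->
  U != 0%VS ->
  exists2 u, u \in U & g u u = 1 /\
    forall v, v \in U -> F v v v v <= F u u u u * g v v ^+ 2.
Proof.
move=> F1 F2 F3 F4 U0.
set d := \dim U; pose b := vbasis U; have bU : basis_of U b := vbasisP U.
pose emb (c : 'rV[R]_d) : V := \sum_i c 0 i *: b`_i.
have embU c : emb c \in U.
  by apply: memv_suml => i _; rewrite memvZ // vbasis_mem ?mem_nth ?size_tuple.
have embK v : v \in U -> v = emb (\row_i coord b i v).
  by move=> vU; rewrite {1}(coord_basis bU vU); apply: eq_bigr => i _; rewrite mxE.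
have emb0 c : emb c = 0 -> c = 0.
  move=> c0; apply/rowP => i; rewrite mxE.
  have /freeP/(_ (fun i => c 0 i)) fb := basis_free bU.
  exact: fb.
have embZ k c : emb (k *: c) = k *: emb c.
  by rewrite scaler_sumr; apply: eq_bigr => i _; rewrite mxE scalerA.
have cc i : continuous (fun c : 'rV[R]_d => c 0 i) := @coord_continuous R _ _ 0 i.
have csum (G : 'I_d -> 'rV[R]_d -> R) : (forall i, continuous (G i)) ->
    continuous (fun c : 'rV[R]_d => \sum_i c 0 i * G i c).
  move=> cG; apply: continuous_big => [|i _ c]; first exact: add_continuous.
  exact: (cvgM (cc i c) (cG i c)).
have cF : continuous (fun c => F (emb c) (emb c) (emb c) (emb c)).
  pose P (c : 'rV[R]_d) := \sum_(i < d) c 0 i * \sum_(j < d) c 0 j *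
    \sum_(k < d) c 0 k * \sum_(l < d) c 0 l * F b`_i b`_j b`_k b`_l.
  have -> : (fun c => F (emb c) (emb c) (emb c) (emb c)) = P.
    apply/funext => c; rewrite {1}/emb (scalar_sum (F1 _ _ _)).
    apply: eq_bigr => i _; congr (_ * _); rewrite {1}/emb (scalar_sum (F2 _ _ _)).
    apply: eq_bigr => j _; congr (_ * _); rewrite {1}/emb (scalar_sum (F3 _ _ _)).
    apply: eq_bigr => k _; congr (_ * _); rewrite {1}/emb (scalar_sum (F4 _ _ _)).
    by [].
  by do 4! apply: (csum) => ?; exact: cst_continuous.
have g1 y : scalar (fun x => g x y) by move=> k u v; rewrite linearPl.
have g2 x : scalar (fun y => g x y) by move=> k u v; rewrite linearPr.
have cg : continuous (fun c => g (emb c) (emb c)).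
  pose P (c : 'rV[R]_d) := \sum_(i < d) c 0 i * \sum_(j < d) c 0 j * g b`_i b`_j.
  have -> : (fun c => g (emb c) (emb c)) = P.
    apply/funext => c; rewrite {1}/emb (scalar_sum (g1 _)).
    apply: eq_bigr => i _; congr (_ * _); rewrite {1}/emb (scalar_sum (g2 _)).
    by [].
  by do 2! apply: (csum) => ?; exact: cst_continuous.
have gpos c : c != 0 -> 0 < g (emb c) (emb c).
  by move=> c0; apply: (neq0_dnorm_gt0 (s := g)); apply: contra_neq c0; exact: emb0.
(* The sphere is taken for the norm of the coordinates, not for [g]; this is harmless because the
   quotient [f] is homogeneous of degree 0. *)
pose A := [set c : 'rV[R]_d | `|c| = 1].
have A0 c : A c -> c != 0 by rewrite /A /= => c1; rewrite -normr_eq0 c1 oner_neq0.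
pose f c := F (emb c) (emb c) (emb c) (emb c) / (g (emb c) (emb c) ^+ 2).
have cptA : compact A.
  apply: bounded_closed_compact.
    by exists 1; split=> // M M1 c /= ->; exact: ltW.
  have -> : A = ((fun c : 'rV[R]_d => `|c|) @^-1` [set 1]) by [].
  apply: closed_comp; last exact: closed_eq.
  by move=> c _; exact: norm_continuous.
have cf : {within A, continuous f}.
  apply: continuous_in_subspaceT => c; rewrite inE => Ac.
  apply: (cvgM (cF c)); apply: cvgV; last exact: (cvgM (cg c) (cg c)).
  by rewrite expf_neq0 // gt_eqF // gpos // A0.
have nA : (A !=set0).
  have [v vU v0] : exists2 v, v \in U & v != 0.
    by exists (vpick U); rewrite ?memv_pick ?vpick0.
  pose c := \row_i coord b i v.
  have c0 : c != 0.
    by apply: contra_neq v0 => c0; rewrite (embK v vU) -/c c0 -(scale0r 0) embZ scale0r.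
  exists (`|c|^-1 *: c); rewrite /A /= normrZ normfV normr_id mulVf //.
  by rewrite normr_eq0.
have [c0 c0A c0max] := EVT_max_rV nA cptA cf.
have c0n : c0 != 0 by apply: A0; move: c0A; rewrite inE.
have gc0 := gpos _ c0n.
have FZ k v : F (k *: v) (k *: v) (k *: v) (k *: v) = k ^+ 4 * F v v v v.
  have Z h : scalar h -> h (k *: v) = k * h v.
    by move=> hl; have := scalar_comb hl k 0 v v; rewrite scale0r mul0r !addr0.
  by rewrite (Z _ (F1 _ _ _)) (Z _ (F2 _ _ _)) (Z _ (F3 _ _ _)) (Z _ (F4 _ _ _)); ring.
have gZ k v : g (k *: v) (k *: v) = k ^+ 2 * g v v.
  by rewrite linearZl_LR /= linearZr_LR /= mulrA.
pose s := Num.sqrt (g (emb c0) (emb c0)).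
have s2 : s ^+ 2 = g (emb c0) (emb c0) by rewrite sqr_sqrtr // ltW.
have s0 : s != 0 by rewrite gt_eqF // sqrtr_gt0.
exists (s^-1 *: emb c0); first by rewrite memvZ.
split; first by rewrite gZ exprVn s2 mulVf // gt_eqF.
move=> v vU; have [->|v0] := eqVneq v 0.
  by rewrite -(scale0r 0) FZ gZ !expr0n /= !mul0r expr0n mulr0.
pose c := \row_i coord b i v; have vE : v = emb c := embK v vU.
have cn : c != 0.
  by apply: contra_neq v0 => c00; rewrite vE c00 -(scale0r 0) embZ scale0r.
have gv := gpos _ cn; rewrite -vE in gv.
have nc : `|c| != 0 by rewrite normr_eq0.
have Ac : `|c|^-1 *: c \in A.
  by rewrite inE /A /= normrZ normfV normr_id mulVf.
have := c0max _ Ac; rewrite /f embZ FZ gZ -vE FZ => fle.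
rewrite -ler_pdivrMr ?exprn_gt0 //.
move: fle; rewrite exprMn -exprM.
have -> : `|c|^-1 ^+ 4 * F v v v v / (`|c|^-1 ^+ (2 * 2) * g v v ^+ 2) = F v v v v / g v v ^+ 2.
  by rewrite -mulf_div divff ?mul1r // expf_neq0 // invr_eq0.
by move=> h; apply: (le_trans h); rewrite -s2 -exprM exprVn mulrC.
Qed.

End Compactness.

Section SelfAdjoint.
Variables (R : realType) (V : vectType R) (g : {dot V for @idfun R}).
Variables (T : 'End(V)) (T_adj : forall x y, g (T x) y = g x (T y)).

Definition eigenfamily (p : R -> V) := forall a, T (p a) = a *: p a.

Definition spectral_sum (s : seq R) (v : V) :=
  exists2 p, eigenfamily p & v = \sum_(a <- s) p a.

Lemma dot_ge0 x : 0 <= g x x.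
Proof.
have [->|x0] := eqVneq x 0; first by rewrite linear0r.
by rewrite ltW // (neq0_dnorm_gt0 (s := g)).
Qed.

Lemma dotC x y : g x y = g y x.
Proof. by rewrite (hermC g) /= expr0 mul1r. Qed.

Lemma dot_suml (I : Type) (r : seq I) (F : I -> V) y :
  g (\sum_(i <- r) F i) y = \sum_(i <- r) g (F i) y.
Proof.
elim: r => [|i r IH]; first by rewrite !big_nil linear0l.
by rewrite !big_cons linearDl /= IH.
Qed.

Lemma eigen_orth a b x y : T x = a *: x -> T y = b *: y -> a != b -> g x y = 0.
Proof.
move=> Tx Ty ab; have := T_adj x y.
rewrite Tx Ty linearZl_LR /= linearZr_LR /= => /eqP.
by rewrite -subr_eq0 -mulrBl mulf_eq0 subr_eq0 (negbTE ab) => /eqP.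
Qed.

Lemma selfadj_eigenvector (U : {vspace V}) : U != 0%VS ->
  (forall x, x \in U -> T x \in U) ->
  exists2 u, u \in U & g u u = 1 /\ exists a, T u = a *: u.
Proof.
move=> U0 TU.
pose F x y z w := g (T x) y * g z w.
have [||||u uU [u1 umax]] := @quartic_max R V g F U _ _ _ _ U0.
- by move=> y z w k a b; rewrite /F linearP linearPl /= mulrDl mulrA.
- by move=> x z w k a b; rewrite /F linearPr /= mulrDl mulrA.
- by move=> x y w k a b; rewrite /F linearPl /=; ring.
- by move=> x y z k a b; rewrite /F linearPr /=; ring.
exists u => //; split=> //.
set l := g (T u) u; exists l.
have {}umax v : v \in U -> g (T v) v <= l * g v v.
  move=> /umax; rewrite /F u1 mulr1 -/l expr2 mulrA.
  have [-> _|v0] := eqVneq v 0; first by rewrite !linear0r /= mulr0.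
  by rewrite ler_pM2r // (neq0_dnorm_gt0 (s := g)).
(* The residual of the eigenvalue equation serves as direction of variation: along it, g (T v) v - l
   g v v has first-order coefficient [2 * g x x], which maximality forces to be 0. *)
have [x xE] : exists x, x = T u - l *: u by exists (T u - l *: u).
have xU : x \in U by rewrite xE rpredB ?TU // memvZ.
have xx : g x x = g (T u) x - l * g u x by rewrite {1}xE linearBl /= linearZl_LR.
have le0 t : 0 < t -> 2 * g x x <= t * (l * g x x - g (T x) x).
  move=> t0; have /umax : u + t *: x \in U by rewrite rpredD // memvZ.
  have -> : T (u + t *: x) = T u + t *: T x by rewrite linearD linearZ.
  rewrite !(linearDl, linearDr) /= !(linearZl_LR, linearZr_LR) /=.
  rewrite -/l u1 (dotC x u) (T_adj x u) (dotC x (T u)) => h.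
  rewrite -(ler_pM2l t0); have /= := congr1 ( *%R t) xx; move: h; lra.
have xx0 : 0 <= g x x := dot_ge0 _.
suff : g x x = 0.
  move=> x0; apply/eqP; rewrite -subr_eq0; apply: contraT => /(neq0_dnorm_gt0 (s := g)).
  by rewrite -xE x0 ltxx.
apply/eqP; rewrite eq_le xx0 andbT leNgt; apply/negP => xpos.
set K := l * g x x - g (T x) x in le0.
have K1 : 0 < `|K| + 1 by rewrite ltr_pwDr.
have := le0 _ (divr_gt0 xpos K1).
apply/negP; rewrite -ltNge -mulrA.
apply: (@le_lt_trans _ _ (g x x * 1)); last by rewrite mulr1; move: xpos; lra.
rewrite ler_pM2l // mulrC ler_pdivrMr // mul1r.
by rewrite (le_trans (ler_norm K)) // lerDl.
Qed.

(** Induction on a bound for the dimension of an invariant subspace: an eigenvector [e] is split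
    off, and its orthogonal complement [U'] inside [U] is invariant because [T] is self-adjoint. *)
Lemma selfadj_spectral :
  exists2 s : seq R, uniq s & forall v, spectral_sum s v.
Proof.
suff H k : forall U : {vspace V}, (\dim U <= k)%N -> (forall x, x \in U -> T x \in U) ->
    exists2 s : seq R, uniq s & forall v, v \in U -> spectral_sum s v.
  have [|s us H'] := H _ fullv (leqnn _); first by move=> *; exact: memvf.
  by exists s => // v; apply: H'; exact: memvf.
elim: k => [|k IH] U dU TU.
  move: dU; rewrite leqn0 dimv_eq0 => /eqP ->.
  exists [::] => // v; rewrite memv0 => /eqP ->.
  by exists (fun=> 0); rewrite ?big_nil // => a; rewrite linear0 scaler0.
have [->|U0] := eqVneq U 0%VS.
  exists [::] => // v; rewrite memv0 => /eqP ->.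
  by exists (fun=> 0); rewrite ?big_nil // => a; rewrite linear0 scaler0.
have [e eU [e1 [a Te]]] := selfadj_eigenvector U0 TU.
pose f : 'Hom(V, R^o) := linfun (g e : V -> R^o).
have fE x : f x = g e x by rewrite lfunE.
pose U' := (U :&: lker f)%VS.
have U'P x : (x \in U') = (x \in U) && (g e x == 0) by rewrite memv_cap memv_ker fE.
have dU' : (\dim U' <= k)%N.
  rewrite -ltnS; apply: leq_trans dU; rewrite ltnNge; apply/negP => dle.
  have : U' == U by rewrite eqEdim capvSl.
  by move=> /eqP UU; move: eU; rewrite -UU U'P e1 oner_eq0 andbF.
have [|s us H] := IH U' dU'.
  move=> x; rewrite !U'P => /andP[xU /eqP gx].
  by rewrite TU //= -T_adj Te linearZl_LR /= gx mulr0.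
exists (if a \in s then s else a :: s); first by case: ifPn => //= ->.
move=> v vU; pose c := g e v.
have /H[p pE vE] : v - c *: e \in U'.
  by rewrite U'P rpredB ?memvZ //= linearBr /= linearZr_LR /= e1 mulr1 subrr.
have -> : v = c *: e + \sum_(b <- s) p b by rewrite -vE addrC subrK.
case: ifPn => as_.
  exists (fun b => p b + if b == a then c *: e else 0).
    move=> b; rewrite linearD /= pE scalerDr; case: eqP => [->|_].
      by rewrite linearZ /= Te !scalerA [c * a]mulrC.
    by rewrite linear0 scaler0.
  rewrite big_split /= addrC; congr (_ + _).
  rewrite (bigD1_seq a) //= eqxx big1 ?addr0 // => b /negbTE ->.
  by [].
exists (fun b => if b == a then c *: e else p b).
  by move=> b; case: eqP => [->|_] //; rewrite linearZ /= Te !scalerA [c * a]mulrC.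
rewrite big_cons eqxx; congr (_ + _).
rewrite big_seq [RHS]big_seq; apply: eq_bigr => b bs.
by case: eqP => // ba; rewrite -ba bs in as_.
Qed.

Lemma dot_spectral (s : seq R) p q : uniq s -> eigenfamily p -> eigenfamily q ->
  g (\sum_(a <- s) p a) (\sum_(a <- s) q a) = \sum_(a <- s) g (p a) (q a).
Proof.
move=> us pE qE; rewrite dot_suml; apply: eq_big_seq => a as_.
rewrite dotC dot_suml (bigD1_seq a) //= big1 ?addr0 1?dotC // => b ba.
by apply: (eigen_orth (qE b) (pE a)).
Qed.

(* The term b = a contributes 0, since 0^-1 = 0. *)
Lemma spectral_gap (s : seq R) v a : uniq s -> spectral_sum s v ->
  `|g (T v - a *: v) v| <=
    (\sum_(b <- s) `|b - a|^-1) * g (T v - a *: v) (T v - a *: v).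
Proof.
move=> us [p pE ->].
have E : T (\sum_(b <- s) p b) - a *: (\sum_(b <- s) p b) = \sum_(b <- s) (b - a) *: p b.
  rewrite linear_sum /= scaler_sumr -sumrB; apply: eq_bigr => b _.
  by rewrite pE scalerBl.
have qE : eigenfamily (fun b => (b - a) *: p b).
  by move=> b; rewrite linearZ /= pE !scalerA mulrC.
rewrite E !dot_spectral //.
apply: (le_trans (ler_norm_sum _ _ _)).
rewrite mulr_sumr big_seq [leRHS]big_seq; apply: ler_sum => b bs.
rewrite !linearZl_LR /= !linearZr_LR /= normrM (ger0_norm (dot_ge0 _)).
have [->|ba] := eqVneq b a; first by rewrite subrr normr0 !mul0r mulr0.
rewrite !mulrA; apply: ler_wpM2r; first exact: dot_ge0.
rewrite -mulrA -expr2 -real_normK ?num_real //.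
rewrite -ler_pdivrMr ?exprn_gt0 ?normr_gt0 ?subr_eq0 //.
rewrite expr2 invfM mulrA divff ?normr_eq0 ?subr_eq0 // mul1r.
rewrite (bigD1_seq b) //= lerDl; apply: sumr_ge0 => *.
by rewrite invr_ge0.
Qed.

End SelfAdjoint.

(** * The complexified curvature operator *)

Section Kahler.
Variables (R : realType) (V : vectType R) (H : hermitian_model V).
Hypothesis H_kahler : kahler H.

Local Notation "''[' x , y ]" := (ip H x%R y%R) : ring_scope.
Local Notation J := (cplx H).
Local Notation A := (curv H).

Lemma ipDl x y z : '[x + y, z] = '[x, z] + '[y, z].
Proof. exact: linearDl. Qed.

Lemma ipDr x y z : '[z, x + y] = '[z, x] + '[z, y].
Proof. exact: linearDr. Qed.

Lemma ipZl a x z : '[a *: x, z] = a * '[x, z].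
Proof. exact: linearZl_LR. Qed.

Lemma ipZr a x z : '[z, a *: x] = a * '[z, x].
Proof. exact: linearZr_LR. Qed.

Lemma ipNl x z : '[- x, z] = - '[x, z].
Proof. exact: linearNl. Qed.

Lemma ipNr x z : '[z, - x] = - '[z, x].
Proof. exact: linearNr. Qed.

Lemma ip0l z : '[0, z] = 0.
Proof. exact: linear0l. Qed.

Lemma ip0r z : '[z, 0] = 0.
Proof. exact: linear0r. Qed.

Definition ipE := (ipDl, ipDr, ipZl, ipZr, ipNl, ipNr, ip0l, ip0r).

Lemma ip_gt0 x : x != 0 -> 0 < '[x, x].
Proof. exact: (neq0_dnorm_gt0 (s := ip H)). Qed.

Lemma ip_ge0 x : 0 <= '[x, x].
Proof. exact: dot_ge0. Qed.

Lemma ipJl x y : '[J x, y] = - '[x, J y].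
Proof. by rewrite -cplx_isometry cplxK ipNl. Qed.

Lemma ip_cplx0l x : '[J x, x] = 0.
Proof. by rewrite ipC ip_cplx0. Qed.

(* kop x z w is the R(x, z) w of the header.  It is locked because rewriting with
   ipDl would otherwise unfold it. *)
Definition kop : V -> V -> V -> V :=
  locked (fun x y z => curv_op H x y z + J (curv_op H x (J y) z)).

Lemma curvJJ x y z w : A (J x) (J y) z w = A x y z w.
Proof. by rewrite -!curv_opP H_kahler. Qed.

Lemma curvN1 x y z w : A (- x) y z w = - A x y z w.
Proof.
have := scalar_comb (curv_linear1 (curv_tensor H) y z w) (-1) 0 x x.
by rewrite scaleN1r scale0r addr0 mulN1r mul0r addr0.
Qed.

Lemma curv_asym x y z w : A x y z w = - A y x z w.
Proof. exact: (curv_antisym (curv_tensor H)). Qed.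

Lemma curv_psym x y z w : A x y z w = A z w x y.
Proof. exact: (curv_pairsym (curv_tensor H)). Qed.

Lemma curv_asym34 x y z w : A x y z w = - A x y w z.
Proof. by rewrite curv_psym curv_asym curv_psym. Qed.

Lemma curvN2 x y z w : A x (- y) z w = - A x y z w.
Proof. by rewrite curv_asym curvN1 -curv_asym. Qed.

Lemma curvN4 x y z w : A x y z (- w) = - A x y z w.
Proof. by rewrite curv_psym curvN2 curv_psym. Qed.

Lemma curvJJ34 x y z w : A x y (J z) (J w) = A x y z w.
Proof. by rewrite curv_psym curvJJ curv_psym. Qed.

Lemma curvJ1 x y z w : A (J x) y z w = - A x (J y) z w.
Proof. by rewrite -curvJJ cplxK curvN1. Qed.

Lemma curvJ3 x y z w : A x y (J z) w = - A x y z (J w).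
Proof. by rewrite curv_psym curvJ1 curv_psym. Qed.

Lemma ip_kop x y z w : '[kop x y z, w] = A x y z w - A x (J y) z (J w).
Proof. by rewrite /kop -lock ipDl ipJl !curv_opP. Qed.

Lemma kopD1 x x' y z : kop (x + x') y z = kop x y z + kop x' y z.
Proof.
have AD p q r : A (x + x') p q r = A x p q r + A x' p q r.
  by have := curv_linear1 (curv_tensor H) p q r 1 x x'; rewrite /= scale1r mul1r.
by apply: (@ip_inj _ _ H) => w; rewrite ipDl !ip_kop !AD; ring.
Qed.

Lemma kopZ1 a x y z : kop (a *: x) y z = a *: kop x y z.
Proof.
have AZ p q r : A (a *: x) p q r = a * A x p q r.
  have := scalar_comb (curv_linear1 (curv_tensor H) p q r) a 0 x x.
  by rewrite scale0r mul0r !addr0.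
by apply: (@ip_inj _ _ H) => w; rewrite ipZl !ip_kop !AZ; ring.
Qed.

(** By Bianchi, exchanging [x] and [z] changes [A x p z q] by [- A z x p q]; the changes for (y, w)
    and (J y, J w) coincide by the Kahler symmetry and cancel. *)
Lemma kopC x y z : kop x y z = kop z y x.
Proof.
apply: (@ip_inj _ _ H) => w; rewrite !ip_kop.
have B p q : A x p z q - A z p x q = - A z x p q.
  have := curv_bianchi (curv_tensor H) x p z q; rewrite (curv_asym p z); lra.
have := B y w; have := B (J y) (J w); rewrite curvJJ34; lra.
Qed.

Lemma kop_adj x y z w : '[kop x y z, w] = '[z, kop y x w].
Proof.
rewrite (ipC _ z) !ip_kop (curv_asym y x w z) (curv_asym34 x y w z) opprK.
by rewrite (curv_asym y) (curv_asym34 _ y w) opprK curvJ1 curvJ3 opprK.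
Qed.

Lemma kopD3 x y z z' : kop x y (z + z') = kop x y z + kop x y z'.
Proof. by rewrite kopC kopD1 !(kopC _ y x). Qed.

Lemma kopZ3 a x y z : kop x y (a *: z) = a *: kop x y z.
Proof. by rewrite kopC kopZ1 kopC. Qed.

Lemma kopD2 x y y' z : kop x (y + y') z = kop x y z + kop x y' z.
Proof. by apply: (@ip_inj _ _ H) => w; rewrite ipDl !kop_adj kopD1 ipDr. Qed.

Lemma kopZ2 a x y z : kop x (a *: y) z = a *: kop x y z.
Proof. by apply: (@ip_inj _ _ H) => w; rewrite ipZl !kop_adj kopZ1 ipZr. Qed.

Lemma kopN1 x y z : kop (- x) y z = - kop x y z.
Proof. by rewrite -scaleN1r kopZ1 scaleN1r. Qed.

Lemma kopN2 x y z : kop x (- y) z = - kop x y z.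
Proof. by rewrite -scaleN1r kopZ2 scaleN1r. Qed.

Lemma kopN3 x y z : kop x y (- z) = - kop x y z.
Proof. by rewrite -scaleN1r kopZ3 scaleN1r. Qed.

Lemma kopJ1 x y z : kop (J x) y z = J (kop x y z).
Proof.
apply: (@ip_inj _ _ H) => w; rewrite ipJl !ip_kop !curvJ1 !cplxK curvN2 curvN4.
by ring.
Qed.

Lemma kopJ3 x y z : kop x y (J z) = J (kop x y z).
Proof. by rewrite kopC kopJ1 kopC. Qed.

Lemma kopJ2 x y z : kop x (J y) z = - J (kop x y z).
Proof.
by apply: (@ip_inj _ _ H) => w; rewrite ipNl ipJl opprK !kop_adj kopJ1 kopJ3.
Qed.

Definition kopE := (kopD1, kopD2, kopD3, kopZ1, kopZ2, kopZ3, kopN1, kopN2, kopN3).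

(** Since [A x x] vanishes, only the term with [A x (J x)] remains, and Bianchi splits it into the
    two Jacobi terms. *)
Lemma jacobi_kop x y : (jacobi H x + jacobi H (J x)) y = kop x x y.
Proof.
apply: (@ip_inj _ _ H) => w; rewrite add_lfunE ipDl !jacobiE !curv_opP ip_kop.
have -> : A x x y w = 0 by have := curv_asym x x y w; lra.
have := curv_bianchi (curv_tensor H) x (J x) y (J w).
rewrite curvJJ34 (curv_asym (J x) y); have := curvJ3 y (J x) x w; lra.
Qed.

Local Notation L := (kop).

Definition holjac x : 'End(V) := jacobi H x + jacobi H (J x).

Lemma holjacE x y : holjac x y = L x x y.
Proof. exact: jacobi_kop. Qed.

Lemma holjac_adj x y z : '[holjac x y, z] = '[y, holjac x z].
Proof. by rewrite !holjacE kop_adj. Qed.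

Lemma leigenspaceP (f : 'End(V)) a x :
  reflect (f x = a *: x) (x \in leigenspace f a).
Proof.
rewrite memv_ker add_lfunE opp_lfunE scale_lfunE id_lfunE subr_eq0.
exact: eqP.
Qed.

(** * Common spectrum of the complex Jacobi operators *)

Definition isospectral (s : seq R) := uniq s /\ forall y, '[y, y] = 1 ->
  (forall v, spectral_sum (holjac y) s v) /\
  (forall a, (a \in s) = leigenvalue (holjac y) a).

Lemma unit_neq0 y : '[y, y] = 1 -> y != 0.
Proof. by move=> y1; apply/eqP => y0; move/eqP: y1; rewrite y0 ip0l eq_sym oner_eq0. Qed.

Lemma complex_jacobi_span y : '[y, y] = 1 ->
  complex_jacobi H (<[y]> + <[J y]>)%VS = holjac y.
Proof.
move=> y1; rewrite (@complex_jacobiE _ _ H _ y) //.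
  exact/complex_line_span/unit_neq0.
by rewrite (subvP (addvSl _ _)) // memv_line.
Qed.

Lemma normalize_unit y : y != 0 -> exists2 c, c != 0 & '[c *: y, c *: y] = 1.
Proof.
move=> y0; have yy := ip_gt0 y0; exists (Num.sqrt '[y, y])^-1.
  by rewrite invr_neq0 // gt_eqF // sqrtr_gt0.
by rewrite ipZl ipZr mulrA -expr2 exprVn sqr_sqrtr ?ltW // mulVf // gt_eqF.
Qed.

Hypothesis H_osserman : complex_osserman H.

(** [isospectral] records no multiplicities; where they matter, they are supplied from here. *)
Lemma dim_eigen_holjac y y' a : '[y, y] = 1 -> '[y', y'] = 1 ->
  \dim (leigenspace (holjac y) a) = \dim (leigenspace (holjac y') a).
Proof.
move=> y1 y'1; rewrite -!complex_jacobi_span //.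
by apply: (proj2 H_osserman); apply/complex_line_span/unit_neq0.
Qed.

Lemma spectral_sum_widen (T : 'End(V)) (s s' : seq R) v : uniq s -> uniq s' ->
  (forall a x, a \in s -> T x = a *: x -> x != 0 -> a \in s') ->
  spectral_sum T s v -> spectral_sum T s' v.
Proof.
move=> us us' ss' [p pE ->]; exists (fun a => if a \in s then p a else 0).
  by move=> a; case: ifP => _; rewrite ?pE // linear0 scaler0.
rewrite -big_mkcond /= -[RHS]big_filter.
rewrite (bigID (mem s')) /= [X in _ + X]big_seq_cond [X in _ + X]big1 ?addr0; last first.
  move=> a /andP[as_ as'_]; apply/eqP; apply: contraNT as'_ => pa0.
  exact: (ss' a (p a)).
rewrite -big_filter; apply: perm_big; apply: uniq_perm; rewrite ?filter_uniq // => a.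
by rewrite !mem_filter andbC.
Qed.

Lemma osserman_isospectral y0 : '[y0, y0] = 1 -> exists s, isospectral s.
Proof.
move=> y01; have [s0 us0 H0] := selfadj_spectral (holjac_adj y0).
have eigE y a : '[y, y] = 1 -> leigenvalue (holjac y) a = leigenvalue (holjac y0) a.
  by move=> y1; rewrite /leigenvalue -!dimv_eq0 (dim_eigen_holjac a y1 y01).
have eig_s0 a : leigenvalue (holjac y0) a -> a \in s0.
  rewrite /leigenvalue -vpick0; have /leigenspaceP := memv_pick (leigenspace (holjac y0) a).
  set e := vpick _ => Te e0; apply: contraNT e0 => as0.
  have [p pE eE] := H0 e; rewrite -/e.
  apply/eqP/(@ip_eq0 _ _ H); rewrite {1}eE dot_suml big_seq big1 // => b bs0.
  apply: (eigen_orth (holjac_adj y0) (pE b) Te).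
  by apply: contraNneq as0 => <-.
exists [seq a <- s0 | leigenvalue (holjac y0) a]; split; first exact: filter_uniq.
move=> y y1; split=> [v|a]; last first.
  rewrite eigE // mem_filter; case: (boolP (leigenvalue _ _)) => //= /eig_s0 ->.
  by [].
have [s us Hs] := selfadj_spectral (holjac_adj y).
apply: (spectral_sum_widen us _ _ (Hs v)); first exact: filter_uniq.
move=> a x _ Tx x0; have ea : leigenvalue (holjac y0) a.
  rewrite -(eigE y) // /leigenvalue; apply/eqP => E0.
  have : x \in leigenspace (holjac y) a by apply/leigenspaceP.
  by rewrite E0 memv0 (negbTE x0).
by rewrite mem_filter ea eig_s0.
Qed.

Variable s : seq R.
Hypothesis s_iso : isospectral s.

Lemma eigen_in y a x : '[y, y] = 1 -> L y y x = a *: x -> x != 0 -> a \in s.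
Proof.
move=> y1 Lx x0; rewrite (proj2 (proj2 s_iso _ y1)) /leigenvalue.
apply/eqP => E0; have : x \in leigenspace (holjac y) a.
  by apply/leigenspaceP; rewrite holjacE.
by rewrite E0 memv0 (negbTE x0).
Qed.

Lemma eigen_ex y a : '[y, y] = 1 -> a \in s -> exists2 x, x != 0 & L y y x = a *: x.
Proof.
move=> y1; rewrite (proj2 (proj2 s_iso _ y1)) /leigenvalue -vpick0 => v0.
exists (vpick (leigenspace (holjac y) a)) => //.
by rewrite -holjacE; apply/leigenspaceP; exact: memv_pick.
Qed.

Lemma eigen_total y v : '[y, y] = 1 ->
  (forall a x, a \in s -> L y y x = a *: x -> '[v, x] = 0) -> v = 0.
Proof.
move=> y1 v0; have [p pE vE] := proj1 (proj2 s_iso _ y1) v.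
apply: (@ip_eq0 _ _ H); rewrite {2}vE ipC dot_suml big_seq big1 // => a as_.
by rewrite ipC; apply: (v0 a) => //; rewrite -holjacE pE.
Qed.

Lemma eigenJ y a x : L y y x = a *: x -> L y y (J x) = a *: J x.
Proof. by rewrite kopJ3 // => ->; rewrite linearZ. Qed.

Lemma kop_orth y a b x z : L y y x = a *: x -> L y y z = b *: z -> a != b -> '[x, z] = 0.
Proof.
rewrite -!holjacE => Tx Tz; exact: (eigen_orth (holjac_adj y) Tx Tz).
Qed.

(* If v is an eigenvector up to an error of order t^k, its Rayleigh quotient is
   accurate to order t^(2k); comparing coefficients of t along y + t x is what
   yields the perturbation identities below. *)
Lemma kop_gap y v a M : 1 <= '[y, y] -> M = L y y v - (a * '[y, y]) *: v ->
  `|'[M, v]| <= (\sum_(b <- s) `|b - a|^-1) * '[M, M].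
Proof.
move=> y_ge1 ME; set C := \sum_(b <- s) _.
have C0 : 0 <= C by apply: sumr_ge0 => b _; rewrite invr_ge0.
have y0 : y != 0 by apply: contraTneq y_ge1 => ->; rewrite ip0l lt_geF // ltr01.
have [c c0 c1] := normalize_unit y0.
have := spectral_gap (holjac_adj (c *: y)) a (proj1 s_iso) (proj1 (proj2 s_iso _ c1) v).
have c2 : c ^+ 2 * '[y, y] = 1 by move: c1; rewrite ipZl ipZr mulrA.
(* The points [y + t *: x] with [x] orthogonal to a unit [y] have norm at least 1, so the
   normalizing factor is at most 1 and the constant [C] can be kept. *)
have c2_le : c ^+ 2 <= 1.
  by rewrite -c2 ler_peMr // sqr_ge0.
have c2_gt : 0 < c ^+ 2 by rewrite exprn_even_gt0.
have -> : holjac (c *: y) v - a *: v = c ^+ 2 *: M.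
  rewrite ME holjacE kopZ1 // kopZ2 // scalerBr !scalerA; congr (_ - _ *: _).
  by rewrite mulrCA c2 mulr1.
rewrite !ipZl ipZr normrM (ger0_norm (ltW c2_gt)) mulrCA ler_pM2l // => h.
apply: (le_trans h); rewrite mulrCA -[leRHS]mul1r ler_wpM2r //.
by rewrite mulr_ge0 ?ip_ge0.
Qed.

(* T_{y + t x} z = T_y z + t (dkop x y z) + t^2 T_x z. *)
Definition dkop : V -> V -> V -> V := locked (fun x y z => L x y z + L y x z).

Lemma dkopE x y z : dkop x y z = L x y z + L y x z.
Proof. by rewrite /dkop -lock. Qed.

Ltac vring := apply: (@ip_inj _ _ H) => ?; rewrite !ipE; ring.

(** * Perturbation identities of first and second order *)

Lemma eigen_first_order_diag y a x z : '[y, y] = 1 -> '[x, y] = 0 ->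
  L y y z = a *: z -> '[dkop x y z, z] = 0.
Proof.
move=> y1 xy Lz.
(* With [z] kept as approximate eigenvector at [y + t *: x], the error is
   [t *: (dkop x y z + t *: b)]; [kop_gap] makes its product with [z] O(t^2), so the term of order t
   vanishes. *)
have [b bE] : exists b, b = L x x z - (a * '[x, x]) *: z by eexists.
set C := \sum_(b <- s) `|b - a|^-1.
apply: (@eq0_of_small _ _ '[b, z] 0 (C * '[dkop x y z, dkop x y z])
  (C * (2 * '[dkop x y z, b])) (C * '[b, b])) => t t0 t1.
have yt : '[y + t *: x, y + t *: x] = 1 + t ^+ 2 * '[x, x].
  by rewrite !ipE (ipC _ y x) xy y1; ring.
have M : t *: (dkop x y z + t *: b) = L (y + t *: x) (y + t *: x) z -
   (a * '[y + t *: x, y + t *: x]) *: z.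
  by rewrite yt bE !dkopE !kopE // Lz; vring.
have := kop_gap _ M; rewrite yt lerDl mulr_ge0 ?sqr_ge0 ?ip_ge0 // => /(_ isT).
rewrite -/C !ipZl ipZr normrM (gtr0_norm t0) mulrCA ler_pM2l //.
rewrite !ipE (ipC _ b (dkop x y z)) mulr0 addr0 => h; apply: (le_trans h).
by rewrite le_eqVlt; apply/orP; left; apply/eqP; ring.
Qed.

Lemma dkop_adj x y z w : '[dkop x y z, w] = '[z, dkop x y w].
Proof. by rewrite !dkopE ipDl ipDr !kop_adj // addrC. Qed.

Lemma eigen_first_order y a x z w : '[y, y] = 1 ->
  L y y z = a *: z -> L y y w = a *: w ->
  '[dkop x y z, w] = 2 * a * '[x, y] * '[z, w].
Proof.
move=> y1 Lz Lw; set c := '[x, y]; pose x' := x - c *: y.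
have x'y : '[x', y] = 0 by rewrite !ipE y1 mulr1 subrr.
have zw0 : '[dkop x' y z, w] = 0.
  have Lzw : L y y (z + w) = a *: (z + w) by rewrite kopD3 // Lz Lw scalerDr.
  have := eigen_first_order_diag y1 x'y Lzw.
  have := eigen_first_order_diag y1 x'y Lz; have := eigen_first_order_diag y1 x'y Lw.
  have -> : dkop x' y (z + w) = dkop x' y z + dkop x' y w.
    by rewrite !dkopE !kopE //; vring.
  rewrite !ipE (dkop_adj x' y w z) (ipC _ w); lra.
move: zw0; rewrite !dkopE !kopE // Lz !ipE; lra.
Qed.

(** Replacing [x] by [J x] and [w] by [J w] keeps one summand of [dkop x y z] and changes the sign
    of the other, since R is complex linear in its first argument and antilinear in its second. *)
Lemma eigen_block y a z w x : '[y, y] = 1 ->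
  L y y z = a *: z -> L y y w = a *: w ->
  '[L x y z, w] = a * ('[x, y] * '[z, w] - '[x, J y] * '[z, J w]).
Proof.
move=> y1 Lz Lw; have := eigen_first_order x y1 Lz Lw.
have := eigen_first_order (J x) y1 Lz (eigenJ Lw).
rewrite !dkopE kopJ1 // kopJ2 // !ipE !cplx_isometry ipJl; lra.
Qed.

(** By the symmetry of R, <T_z y, v> is <R(v, y) z, z>, a diagonal case of [eigen_block] whose
    second term dies with <z, J z>. *)
Lemma eigen_sym y a z : '[y, y] = 1 -> L y y z = a *: z ->
  L z z y = (a * '[z, z]) *: y.
Proof.
move=> y1 Lz; apply: (@ip_inj _ _ H) => v.
rewrite (kopC z z y) kop_adj (kopC z y v) ipC (eigen_block v y1 Lz Lz) ip_cplx0.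
by rewrite ipZl (ipC _ y); ring.
Qed.

(* z + t u is an eigenvector of T_{y + t x} up to an error of order t^2. *)
Lemma eigen_second_order_diag y a x z u : '[y, y] = 1 -> '[x, y] = 0 ->
  L y y z = a *: z -> L y y u = a *: u - dkop x y z ->
  '[L x x z, z] - a * '[x, x] * '[z, z] + '[u, dkop x y z] = 0.
Proof.
move=> y1 xy Lz Lu.
(* [p] and [b] are the coefficients of t^2 and t^3 in the error at [z + t *: u]; the equation for
   [u] cancels the term of order t. *)
have [p pE] : exists p, p = dkop x y u + L x x z - (a * '[x, x]) *: z by eexists.
have [b bE] : exists b, b = L x x u - (a * '[x, x]) *: u by eexists.
transitivity '[p, z]; first by rewrite pE !ipE dkop_adj; ring.
set C := \sum_(b <- s) `|b - a|^-1.
apply: (@eq0_of_small _ _ ('[p, u] + '[b, z]) '[b, u]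
  0 (C * '[p, p]) (C * (2 * '[p, b] + '[b, b]))) => t t0 t1.
have yt : '[y + t *: x, y + t *: x] = 1 + t ^+ 2 * '[x, x].
  by rewrite !ipE (ipC _ y x) xy y1; ring.
have M : t ^+ 2 *: (p + t *: b) = L (y + t *: x) (y + t *: x) (z + t *: u) -
   (a * '[y + t *: x, y + t *: x]) *: (z + t *: u).
  by rewrite yt pE bE !dkopE !kopE // Lz Lu !dkopE; vring.
have := kop_gap _ M; rewrite yt lerDl mulr_ge0 ?sqr_ge0 ?ip_ge0 // => /(_ isT).
have t2 : 0 < t ^+ 2 by rewrite exprn_gt0.
rewrite -/C !ipZl ipZr normrM (gtr0_norm t2) mulrCA ler_pM2l //.
rewrite !ipE (ipC _ b p) => h.
have -> : '[p, z] + t * ('[p, u] + '[b, z]) + t ^+ 2 * '[b, u] =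
   '[p, z] + t * '[p, u] + (t * '[b, z] + t * (t * '[b, u])) by ring.
apply: (le_trans h).
have -> : C * (t ^+ 2 * ('[p, p] + t * '[p, b] + (t * '[p, b] + t * (t * '[b, b])))) =
  t * (0 + t * (C * '[p, p]) + t ^+ 2 * (C * (2 * '[p, b] + t * '[b, b]))) by ring.
rewrite ler_pM2l // lerD2l ler_pM2l // ler_wpM2l //.
  by apply: sumr_ge0 => d _; rewrite invr_ge0.
by rewrite lerD2l ler_piMl // ip_ge0.
Qed.

Lemma eigen_second_order y a x z u z' u' : '[y, y] = 1 -> '[x, y] = 0 ->
  L y y z = a *: z -> L y y u = a *: u - dkop x y z ->
  L y y z' = a *: z' -> L y y u' = a *: u' - dkop x y z' ->
  '[L x x z, z'] - a * '[x, x] * '[z, z'] + '[u, dkop x y z'] = 0.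
Proof.
move=> y1 xy Lz Lu Lz' Lu'.
have dD : dkop x y (z + z') = dkop x y z + dkop x y z'.
  by rewrite !dkopE !kopE //; vring.
have Lzz : L y y (z + z') = a *: (z + z') by rewrite kopD3 // Lz Lz' scalerDr.
have Luu : L y y (u + u') = a *: (u + u') - dkop x y (z + z').
  by rewrite dD kopD3 // Lu Lu'; vring.
have sym : '[u', dkop x y z] = '[u, dkop x y z'].
  have E : '[L y y u, u'] = '[u, L y y u'] by rewrite kop_adj.
  move: E; rewrite Lu Lu' !ipE (ipC _ (dkop x y z)); lra.
have := eigen_second_order_diag y1 xy Lzz Luu.
have := eigen_second_order_diag y1 xy Lz Lu.
have := eigen_second_order_diag y1 xy Lz' Lu'.
have K : '[L x x z', z] = '[L x x z, z'] by rewrite kop_adj // ipC.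
rewrite dD kopD3 // !ipE sym K (ipC _ z' z); lra.
Qed.

(** * Maxima of the holomorphic sectional curvature *)

Variables (y : V) (Lam : R).
Hypotheses (y1 : '[y, y] = 1) (Lam_gt0 : 0 < Lam).
(* hsc: holomorphic sectional curvature *)
Hypothesis hsc_le : forall x, '[L x x x, x] <= Lam * '[x, x] ^+ 2.
Hypothesis hsc_y : '[L y y y, y] = Lam.

Lemma kop_sym x u z w : '[L x u z, w] = '[L u x w, z].
Proof. by rewrite kop_adj ipC. Qed.

Lemma hsc_expand x t : '[L (y + t *: x) (y + t *: x) (y + t *: x), y + t *: x] =
  '[L y y y, y] + t * (4 * '[L y y y, x]) + t ^+ 2 * (4 * '[L y y x, x] + 2 * '[L y x y, x])
  + t ^+ 3 * (4 * '[L x x x, y]) + t ^+ 4 * '[L x x x, x].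
Proof.
have e1 : '[L y y x, y] = '[L y y y, x] by rewrite kop_sym.
have e2 : '[L x y y, y] = '[L y y y, x] by rewrite kopC.
have e3 : '[L y x y, y] = '[L y y y, x] by rewrite kop_sym.
have f1 : '[L x y y, x] = '[L y y x, x] by rewrite kopC.
have f2 : '[L y x x, y] = '[L y y x, x] by rewrite kop_sym.
have f3 : '[L x x y, y] = '[L y y x, x] by rewrite kopC f2.
have f4 : '[L x y x, y] = '[L y x y, x] by rewrite kop_sym.
have g1 : '[L x x y, x] = '[L x x x, y] by rewrite kop_sym.
have g2 : '[L y x x, x] = '[L x x x, y] by rewrite kopC.
have g3 : '[L x y x, x] = '[L x x x, y] by rewrite kop_sym.
by rewrite !kopE // !ipE e1 e2 e3 f1 f2 f3 f4 g1 g2 g3; ring.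
Qed.

Lemma hsc_bound x t : '[x, y] = 0 ->
  t * (4 * '[L y y y, x]) +
  t ^+ 2 * (4 * '[L y y x, x] + 2 * '[L y x y, x] - 2 * (Lam * '[x, x]))
  + t ^+ 3 * (4 * '[L x x x, y]) + t ^+ 4 * ('[L x x x, x] - Lam * '[x, x] ^+ 2) <= 0.
Proof.
move=> xy; have := hsc_le (y + t *: x); rewrite hsc_expand !ipE xy (ipC _ y x) xy y1 hsc_y.
lra.
Qed.

Lemma hsc_grad x : '[x, y] = 0 -> '[L y y y, x] = 0.
Proof.
suff H0 x' : '[x', y] = 0 -> '[L y y y, x'] <= 0.
  move=> xy; apply/eqP; rewrite eq_le H0 //= -oppr_le0 -ipNr H0 //.
  by rewrite ipNl xy oppr0.
move=> xy.
(* This is [hsc_bound] divided by 4 t. *)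
apply: (@cubic_le0 _ _ (('[L y y x', x'] + '[L y x' y, x'] / 2 - (Lam * '[x', x']) / 2))
  ('[L x' x' x', y]) (('[L x' x' x', x'] - Lam * '[x', x'] ^+ 2) / 4)) => t t0.
rewrite -(pmulr_rle0 _ t0) -(@pmulr_rle0 _ 4) //.
apply: le_trans (hsc_bound t xy); rewrite le_eqVlt; apply/orP; left; apply/eqP.
by field.
Qed.

Lemma max_eigen : L y y y = Lam *: y.
Proof.
apply: (@ip_inj _ _ H) => v; rewrite ipZl.
have := @hsc_grad (v - '[v, y] *: y); rewrite !ipE y1 mulr1 subrr hsc_y (ipC _ y v) => /(_ erefl).
lra.
Qed.

Lemma max_hess x : '[x, y] = 0 -> 2 * '[L y y x, x] + '[L y x y, x] <= Lam * '[x, x].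
Proof.
move=> xy; have g0 := hsc_grad xy.
suff : 4 * '[L y y x, x] + 2 * '[L y x y, x] - 2 * (Lam * '[x, x]) <= 0 by lra.
apply: (@cubic_le0 _ _ (4 * '[L x x x, y]) ('[L x x x, x] - Lam * '[x, x] ^+ 2) 0) => t t0.
rewrite -(@pmulr_rle0 _ (t ^+ 2)) ?exprn_gt0 //.
apply: le_trans (hsc_bound t xy); rewrite g0 le_eqVlt; apply/orP; left; apply/eqP.
by ring.
Qed.

(** Averaging the Hessian bound over [x] and [J x] removes the term in [L y x y], which is
    antilinear in [x]. *)
Lemma max_bisectional x : '[x, y] = 0 -> '[x, J y] = 0 ->
  2 * '[L y y x, x] <= Lam * '[x, x].
Proof.
move=> xy xJy; have := max_hess xy; have := @max_hess (J x).
rewrite ipJl xJy oppr0 kopJ3 // kopJ2 // ipNl !cplx_isometry => /(_ erefl); lra.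
Qed.

(** The part [v] of [x] orthogonal to [y] and [J y] is again in E_Lam, where [max_bisectional] gives
    2 Lam |v|^2 <= Lam |v|^2. *)
Lemma max_eigenspace x : L y y x = Lam *: x -> x = '[x, y] *: y + '[x, J y] *: J y.
Proof.
move=> Lx; have [v vE] : exists v, v = x - '[x, y] *: y - '[x, J y] *: J y by eexists.
have vy : '[v, y] = 0 by rewrite vE !ipE ip_cplx0l y1; ring.
have vJ : '[v, J y] = 0 by rewrite vE !ipE cplx_isometry ip_cplx0 y1; ring.
have Lv : L y y v = Lam *: v.
  by rewrite vE !kopE // (eigenJ max_eigen) max_eigen Lx; vring.
have := max_bisectional vy vJ; rewrite Lv ipZl => h.
have v0 : v = 0.
  apply/eqP; apply: contraT => /ip_gt0 vv; move: h.
  by have := mulr_gt0 Lam_gt0 vv; lra.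
by apply/eqP; rewrite -subr_eq0 opprD addrA -vE v0.
Qed.

Lemma max_orth a x : a != Lam -> L y y x = a *: x -> '[x, y] = 0 /\ '[x, J y] = 0.
Proof.
move=> aL Lx; split.
  exact: kop_orth Lx max_eigen aL.
exact: kop_orth Lx (eigenJ max_eigen) aL.
Qed.

Lemma max_orth_top v x : '[v, y] = 0 -> '[v, J y] = 0 -> L y y x = Lam *: x -> '[v, x] = 0.
Proof. by move=> vy vJ /max_eigenspace ->; rewrite !ipE vy vJ !mulr0 addr0. Qed.

Lemma max_eigenvalue_le a : a \in s -> a != Lam -> 2 * a <= Lam.
Proof.
move=> as_ aL; have [x x0 Lx] := eigen_ex y1 as_.
have [xy xJ] := max_orth aL Lx; have := max_bisectional xy xJ.
by rewrite Lx ipZl mulrA ler_pM2r // ip_gt0.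
Qed.

Lemma max_eigenvalue_in : Lam \in s.
Proof. exact: eigen_in y1 max_eigen (unit_neq0 y1). Qed.

Lemma max_resolvent v : '[v, y] = 0 -> '[v, J y] = 0 ->
  exists u, L y y u = Lam *: u - v.
Proof.
move=> vy vJ; have [p pE vE] := proj1 (proj2 s_iso _ y1) v.
have pL : p Lam = 0.
  have Lp : L y y (p Lam) = Lam *: p Lam by rewrite -holjacE pE.
  apply: (@ip_eq0 _ _ H); rewrite -[RHS](max_orth_top vy vJ Lp) vE dot_suml.
  rewrite (bigD1_seq Lam) ?(proj1 s_iso) ?max_eigenvalue_in //=.
  rewrite big1 ?addr0 // => b bL.
  exact: (eigen_orth (holjac_adj y) (pE b) (pE Lam)).
(* At [a = Lam] the factor is [0^-1 = 0], which is right because [p Lam] is 0. *)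
exists (\sum_(a <- s) (Lam - a)^-1 *: p a).
rewrite -holjacE linear_sum scaler_sumr vE -sumrB; apply: eq_bigr => a _.
have [->|aL] := eqVneq a Lam; first by rewrite pL !scaler0 linear0 subr0.
have d0 : Lam - a != 0 by rewrite subr_eq0 eq_sym.
rewrite linearZ /= pE; apply: (@ip_inj _ _ H) => w; rewrite !ipE; field.
exact: d0.
Qed.

(** * The symmetric antilinear map sigma : x -> R(y, x) y *)

Lemma max_sigma_orth x : '[x, y] = 0 -> '[x, J y] = 0 ->
  '[L y x y, y] = 0 /\ '[L y x y, J y] = 0.
Proof.
move=> xy xJ; split; rewrite kop_sym.
  by rewrite (kopC x) kop_sym max_eigen ipZl (ipC _ y) xy mulr0.
rewrite kopJ3 // ipJl (kopC x) kop_sym (eigenJ max_eigen) ipZl (ipC _ (J y)) xJ.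
by rewrite mulr0 oppr0.
Qed.

(** The second-order identity is applied to the eigenvector [y] itself: moving [y] towards [x]
    perturbs T_y y by T_y x + sigma x, and the corrector [m + g] solves for both parts. *)
Lemma max_second_order x m g : '[x, y] = 0 ->
  L y y m = Lam *: m - L y y x -> L y y g = Lam *: g - L y x y ->
  '[L y y x, x] - Lam * '[x, x] + '[m + g, L y y x + L y x y] = 0.
Proof.
move=> xy Lm Lg.
have dE : dkop x y y = L y y x + L y x y by rewrite dkopE (kopC x).
have := eigen_second_order_diag y1 xy max_eigen (u := m + g).
rewrite dE kopD3 // Lm Lg y1 mulr1 => <-; last by vring.
by congr (_ - _ + _); rewrite (kopC x) kop_sym (kopC x).
Qed.

(** For [J x] the correctors become [J m] and [- J g], so the mixed terms change sign and the
    identity splits in two. *)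
Lemma max_second_orderJ x m g : '[x, y] = 0 -> '[x, J y] = 0 ->
  L y y m = Lam *: m - L y y x -> L y y g = Lam *: g - L y x y ->
  '[m, L y x y] = 0 /\ '[L y y x, x] - Lam * '[x, x] + '[m, L y y x] + '[g, L y x y] = 0.
Proof.
move=> xy xJ Lm Lg.
have h1 := max_second_order xy Lm Lg.
have JxJ : '[J x, y] = 0 by rewrite ipJl xJ oppr0.
have LJm : L y y (J m) = Lam *: J m - L y y (J x).
  by rewrite !kopJ3 // Lm linearB linearZ.
have LJg : L y y (- J g) = Lam *: (- J g) - L y (J x) y.
  by rewrite kopN3 // kopJ3 // kopJ2 // Lg linearB linearZ /=; vring.
have := max_second_order JxJ LJm LJg.
have E : '[m, L y x y] = '[g, L y y x].
  have : '[L y y m, g] = '[m, L y y g] by rewrite kop_adj.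
  rewrite Lm Lg !ipE (ipC _ (L y y x)); lra.
rewrite kopJ3 // kopJ2 // !ipE !cplx_isometry.
move: h1; rewrite !ipE E; lra.
Qed.

Lemma max_sigma_sym x z : '[L y x y, z] = '[L y z y, x].
Proof. by rewrite kop_sym kopC kop_sym. Qed.

(** Obtained by polarizing <m, sigma x> = 0 with [m] equal to a / (Lam - a) times [x]. For nonzero
    [a] and [b] the factor vanishes exactly when 1/a + 1/b = 2/Lam, so sigma pairs E_a only with its
    partner. *)
Lemma max_sigma_pair a b x z : a != Lam -> b != Lam ->
  L y y x = a *: x -> L y y z = b *: z ->
  (a * (Lam - b) + b * (Lam - a)) * '[L y x y, z] = 0.
Proof.
move=> aL bL Lx Lz.
have [xy xJ] := max_orth aL Lx; have [zy zJ] := max_orth bL Lz.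
have a0 : Lam - a != 0 by rewrite subr_eq0 eq_sym.
have b0 : Lam - b != 0 by rewrite subr_eq0 eq_sym.
have mE c w : Lam - c != 0 -> L y y w = c *: w ->
    L y y ((c / (Lam - c)) *: w) = Lam *: ((c / (Lam - c)) *: w) - L y y w.
  move=> c0 Lw; rewrite kopZ3 // Lw !scalerA -scalerBl; congr (_ *: _).
  by field.
have key w m : '[w, y] = 0 -> '[w, J y] = 0 -> L y y m = Lam *: m - L y y w ->
    '[m, L y w y] = 0.
  move=> wy wJ Lm; have [sy sJ] := max_sigma_orth wy wJ.
  have [g Lg] := max_resolvent sy sJ.
  exact: (proj1 (max_second_orderJ wy wJ Lm Lg)).
have k1 := key _ _ xy xJ (mE _ _ a0 Lx); have k2 := key _ _ zy zJ (mE _ _ b0 Lz).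
have := key (x + z) ((a / (Lam - a)) *: x + (b / (Lam - b)) *: z).
rewrite !ipE xy zy xJ zJ addr0 => /(_ erefl erefl).
rewrite !kopD3 // (mE _ _ a0 Lx) (mE _ _ b0 Lz) !kopE //.
have mD : Lam *: ((a / (Lam - a)) *: x) - L y y x + (Lam *: ((b / (Lam - b)) *: z) - L y y z)
   = Lam *: ((a / (Lam - a)) *: x + (b / (Lam - b)) *: z) - (L y y x + L y y z) by vring.
move=> /(_ mD).
rewrite !ipE (mulrDr (a / _)) (mulrDr (b / _)); move: k1 k2; rewrite !ipE => -> ->; rewrite add0r addr0.
rewrite (ipC _ z) (ipC _ x) (max_sigma_sym z x) -mulrDl => /eqP.
rewrite mulf_eq0 => /orP[|/eqP->]; last by rewrite mulr0.
rewrite addf_div // mulf_eq0 invr_eq0 mulf_eq0 (negbTE a0) (negbTE b0) !orbF => /eqP->.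
by rewrite mul0r.
Qed.

Lemma max_sigma_norm a x : a != Lam -> L y y x = a *: x ->
  exists2 g, L y y g = Lam *: g - L y x y &
    (Lam - a) * '[g, L y x y] = Lam * (Lam - 2 * a) * '[x, x].
Proof.
move=> aL Lx; have [xy xJ] := max_orth aL Lx.
have [sy sJ] := max_sigma_orth xy xJ; have [g Lg] := max_resolvent sy sJ.
exists g => //; have a0 : Lam - a != 0 by rewrite subr_eq0 eq_sym.
have Lm : L y y ((a / (Lam - a)) *: x) = Lam *: ((a / (Lam - a)) *: x) - L y y x.
  by rewrite kopZ3 // Lx !scalerA -scalerBl; congr (_ *: _); field.
have [_] := max_second_orderJ xy xJ Lm Lg.
rewrite Lx !ipE => /(canRL (addKr _)) ->; field.
exact: a0.
Qed.

(** Without a partner, sigma x would be 0 by [max_sigma_pair], while [max_sigma_norm] makes it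
    nonzero unless 2 a = Lam. *)
Lemma max_partner a : a \in s -> a != Lam -> a != 0 -> 2 * a != Lam ->
  exists2 b, b \in s & a * (Lam - b) + b * (Lam - a) = 0.
Proof.
move=> as_ aL a0 a2; have [x x0 Lx] := eigen_ex y1 as_.
have [/hasP[b bs /eqP E]|/hasPn nb] :=
  boolP (has (fun b => a * (Lam - b) + b * (Lam - a) == 0) s); first by exists b.
have [xy xJ] := max_orth aL Lx; have [sy sJ] := max_sigma_orth xy xJ.
have s0 : L y x y = 0.
  apply: (eigen_total y1) => b z bs Lz.
  have [bE|bL] := eqVneq b Lam; first by apply: max_orth_top => //; rewrite -bE.
  have /eqP := max_sigma_pair aL bL Lx Lz.
  by rewrite mulf_eq0 (negbTE (nb _ bs)) => /eqP.
have [g _] := max_sigma_norm aL Lx.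
rewrite s0 ip0r mulr0 => /esym/eqP; rewrite !mulf_eq0 (gt_eqF Lam_gt0) (gt_eqF (ip_gt0 x0)).
by rewrite subr_eq0 eq_sym (negbTE a2).
Qed.

(** For a = Lam / 2 the factor in [max_sigma_pair] is 2 a^2 whatever [b] is, so sigma x has no
    component outside E_Lam, and [max_sigma_orth] excludes that one. *)
Lemma max_sigma_half a x : 2 * a = Lam -> L y y x = a *: x -> L y x y = 0.
Proof.
move=> a2 Lx; have a0 : a != 0 by apply: contraTneq Lam_gt0 => a0; rewrite -a2 a0 mulr0 ltxx.
have aL : a != Lam by apply: contra_neq a0 => aL; move: a2; rewrite aL; lra.
have [xy xJ] := max_orth aL Lx; have [sy sJ] := max_sigma_orth xy xJ.
apply: (eigen_total y1) => b z bs Lz.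
have [bE|bL] := eqVneq b Lam; first by apply: max_orth_top => //; rewrite -bE.
have /eqP := max_sigma_pair aL bL Lx Lz.
have -> : a * (Lam - b) + b * (Lam - a) = 2 * (a * a) by rewrite -a2; ring.
by rewrite !mulf_eq0 (negbTE a0) pnatr_eq0 => /eqP.
Qed.

(** For a = 0 the factor in [max_sigma_pair] is b Lam, so sigma preserves the kernel of T_y; there
    the corrector [g] of [max_sigma_norm] satisfies Lam <g, sigma x> = |sigma x|^2. *)
Lemma max_sigma_ker x : L y y x = 0 ->
  L y y (L y x y) = 0 /\ '[L y x y, L y x y] = Lam ^+ 2 * '[x, x].
Proof.
move=> Lx0; have Lx : L y y x = 0 *: x by rewrite scale0r.
have aL : 0 != Lam by rewrite lt_eqF.
have [xy xJ] := max_orth aL Lx; have [sy sJ] := max_sigma_orth xy xJ.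
have K0 : L y y (L y x y) = 0.
  apply: (eigen_total y1) => b z bs Lz; rewrite kop_adj Lz ipZr.
  have [bE|bL] := eqVneq b Lam.
    by rewrite (max_orth_top sy sJ) ?mulr0 // -bE.
  have /eqP := max_sigma_pair aL bL Lx Lz.
  rewrite mul0r add0r subr0 -mulrA mulf_eq0 => /orP[/eqP->|]; first by rewrite mul0r.
  by rewrite mulf_eq0 (gt_eqF Lam_gt0) => /eqP ->; rewrite mulr0.
split=> //; have [g Lg] := max_sigma_norm aL Lx.
have : '[L y y g, L y x y] = 0 by rewrite kop_adj K0 ip0r.
by rewrite Lg !ipE => /eqP; rewrite subr_eq0 => /eqP <-; rewrite !subr0 mulr0 subr0 => ->; ring.
Qed.

Lemma kop_le_of_spectrum x v K : '[x, x] = 1 ->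
  (forall a, a \in s -> a <= K \/ (forall u, L x x u = a *: u -> '[v, u] = 0)) ->
  '[L x x v, v] <= K * '[v, v].
Proof.
move=> x1 hK; have [p pE vE] := proj1 (proj2 s_iso _ x1) v.
have us := proj1 s_iso.
have Lv : L x x v = \sum_(a <- s) a *: p a.
  by rewrite -holjacE vE linear_sum; apply: eq_bigr => a _; rewrite /= pE.
have qE : eigenfamily (holjac x) (fun a => a *: p a).
  by move=> a; rewrite linearZ /= pE.
have adj := holjac_adj x.
rewrite Lv {1}vE (dot_spectral adj us qE pE) {1}vE {1}vE (dot_spectral adj us pE pE) mulr_sumr.
rewrite big_seq [leRHS]big_seq; apply: ler_sum => a as_; rewrite ipZl.
have [aK|orth] := hK a as_; first by rewrite ler_wpM2r // ip_ge0.
have -> : '[p a, p a] = 0; last by rewrite !mulr0.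
rewrite -(orth (p a)); last by rewrite -holjacE pE.
rewrite vE dot_suml (bigD1_seq a) //= big1 ?addr0 // => b ba.
exact: (eigen_orth adj (pE b) (pE a)).
Qed.

(** * Excluding the simultaneous eigenvalues Lam / 2 and 0 *)

Hypothesis s_three : forall a, a \in s -> [\/ a = Lam, a = Lam / 2 | a = 0].

Local Notation N1 z := (L y y z = (Lam / 2) *: z).
Local Notation N0 w := (L y y w = 0).

Let half_neq : Lam / 2 != Lam.
Proof. by apply/eqP; move: Lam_gt0; lra. Qed.

Let zero_neq : 0 != Lam.
Proof. by rewrite lt_eqF. Qed.

Lemma N0E w : N0 w -> L y y w = 0 *: w.
Proof. by rewrite scale0r. Qed.

Lemma N1_orth z : N1 z -> '[z, y] = 0 /\ '[z, J y] = 0.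
Proof. exact: max_orth half_neq. Qed.

Lemma N0_orth w : N0 w -> '[w, y] = 0 /\ '[w, J y] = 0.
Proof. by move=> /N0E; exact: max_orth zero_neq. Qed.

Lemma N1_N0_orth z w : N1 z -> N0 w -> '[z, w] = 0.
Proof.
move=> Lz /N0E Lw; apply: kop_orth Lz Lw _.
by rewrite mulf_neq0 ?gt_eqF // invr_gt0.
Qed.

Lemma N1J z : N1 z -> N1 (J z).
Proof. exact: eigenJ. Qed.

Lemma N0J w : N0 w -> N0 (J w).
Proof. by move=> Lw; rewrite kopJ3 // Lw linear0. Qed.

(** By [s_three] only three eigenspaces occur, so membership in one is tested by orthogonality to
    the others. *)
Lemma eigen_mem v c : (c != Lam -> '[v, y] = 0 /\ '[v, J y] = 0) ->
  (c != Lam / 2 -> forall z, N1 z -> '[v, z] = 0) ->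
  (c != 0 -> forall w, N0 w -> '[v, w] = 0) ->
  L y y v = c *: v.
Proof.
move=> vL v1 v0; apply/eqP; rewrite -subr_eq0; apply/eqP.
apply: (eigen_total y1) => a x as_ Lx.
rewrite ipDl ipNl ipZl kop_adj Lx ipZr -mulrBl.
have [->|ca] := eqVneq c a; first by rewrite subrr mul0r.
have -> : '[v, x] = 0; last by rewrite mulr0.
have [aE|aE|aE] := s_three as_; rewrite aE in ca Lx.
- have [vy vJ] := vL ca; exact: max_orth_top.
- exact: v1.
- by apply: v0; rewrite ?Lx ?scale0r.
Qed.

Lemma vec_eq0 v : '[v, y] = 0 -> '[v, J y] = 0 ->
  (forall z, N1 z -> '[v, z] = 0) -> (forall w, N0 w -> '[v, w] = 0) -> v = 0.
Proof.
move=> vy vJ v1 v0; have E := @eigen_mem v _ (fun _ => conj vy vJ) (fun _ => v1) (fun _ => v0).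
have := E 0; rewrite (E Lam) scale0r => /eqP; rewrite scaler_eq0 gt_eqF //= => /eqP.
by [].
Qed.

(** * Products R(x, y) w and R(y, x) w between the eigenspaces of T_y *)

Lemma N1_N0_mul z w : N1 z -> N0 w -> L z y w = 0.
Proof.
move=> Lz Lw; have [zy zJ] := N1_orth Lz; have [wy wJ] := N0_orth Lw.
have sz : L y z y = 0 by apply: max_sigma_half Lz; lra.
apply: vec_eq0 => [||z' Lz'|w' Lw'].
- by rewrite kop_sym sz ip0l.
- by rewrite kop_sym kopJ3 // sz linear0 ip0l.
- by rewrite (kopC z) (eigen_block _ y1 Lz Lz') wy wJ !mul0r subrr mulr0.
- by rewrite (eigen_block _ y1 (N0E Lw) (N0E Lw')) mul0r.
Qed.

Lemma N1_N1_mul z z' : N1 z -> N1 z' -> N0 (L z y z').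
Proof.
move=> Lz Lz'; have [zy zJ] := N1_orth Lz.
have sz : L y z y = 0 by apply: max_sigma_half Lz; lra.
rewrite -[RHS](scale0r (L z y z')); apply: eigen_mem => [_|_ t Lt|/eqP //].
  by split; rewrite kop_sym; [rewrite sz ip0l|rewrite kopJ3 // sz linear0 ip0l].
by rewrite (eigen_block _ y1 Lz' Lt) zy zJ !mul0r subrr mulr0.
Qed.

Lemma N0_N0_conjmul w w' : N0 w -> N0 w' -> L y w w' = 0.
Proof.
move=> Lw Lw'; apply: vec_eq0 => [||z Lz|t Lt]; rewrite kop_sym.
- by rewrite kopC Lw ip0l.
- by rewrite kopJ3 // kopC Lw linear0 ip0l.
- by rewrite kopC N1_N0_mul // ip0l.
- by rewrite (eigen_block _ y1 (N0E Lt) (N0E Lw')) mul0r.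
Qed.

Lemma kop_le x v : '[L x x v, v] <= Lam * '[x, x] * '[v, v].
Proof.
have [->|x0] := eqVneq x 0.
  have -> : L 0 0 v = 0 by have := kopZ1 0 0 0 v; rewrite !scale0r.
  by rewrite !ip0l mulr0 mul0r.
have [c c0 c1] := normalize_unit x0.
have c2 : 0 < c * c by rewrite -expr2 exprn_even_gt0.
have : '[L (c *: x) (c *: x) v, v] <= Lam * '[v, v].
  apply: kop_le_of_spectrum => // a /s_three[]->; left => //.
    by move: Lam_gt0; lra.
  exact: ltW.
rewrite kopZ1 // kopZ2 // !ipZl mulrA -(ler_pM2l c2) => h.
rewrite -(ler_pM2l c2) -(ler_pM2l c2); apply: (le_trans h).
have E : c * c * '[x, x] = 1 by move: c1; rewrite ipZl ipZr mulrA.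
rewrite le_eqVlt; apply/orP; left; apply/eqP.
by rewrite -[in LHS](mulr1 (c * c)) -E; ring.
Qed.

(** Equality in a Rayleigh bound makes the first variation vanish. [U] only has to contain the line
    through [v] in direction [u], so the bound may be restricted to a subspace. *)
Lemma psd_kernel (U : V -> Prop) x K v u :
  (forall t : R, U (v + t *: u)) ->
  (forall v', U v' -> '[L x x v', v'] <= K * '[v', v']) ->
  '[L x x v, v] = K * '[v, v] -> '[L x x v, u] = K * '[v, u].
Proof.
move=> Uvu hK hv.
have key u' : (forall t : R, U (v + t *: u')) -> '[L x x v, u'] - K * '[v, u'] <= 0.
  move=> Uvu'; apply: (@cubic_le0 _ _ (('[L x x u', u'] - K * '[u', u']) / 2) 0 0) => t t0.
  rewrite -(pmulr_rle0 _ t0) -(@pmulr_rle0 _ 2) //.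
  have := hK _ (Uvu' t); rewrite kopD3 // kopZ3 // !ipE hv (kop_sym x x u') (ipC _ u' v).
  rewrite (ipC _ (L x x v)); lra.
have := key u Uvu; have := key (- u); rewrite !ipE.
have Uvn (t : R) : U (v + t *: - u) by have := Uvu (- t); rewrite scaleNr scalerN.
move=> /(_ Uvn); lra.
Qed.

Lemma kop_top x v : '[L x x v, v] = Lam * '[x, x] * '[v, v] ->
  L x x v = (Lam * '[x, x]) *: v.
Proof.
move=> h; apply: (@ip_inj _ _ H) => u; rewrite ipZl.
exact: (@psd_kernel (fun=> True) _ _ _ _ (fun=> I) (fun v' _ => kop_le x v') h).
Qed.

(** * The kernel of T_y *)

Lemma N0_N0_second_order w w' : N0 w -> N0 w' ->
  exists2 C, (forall z, N1 z -> '[L w y w', z] = '[C, z]) & N1 C /\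
  '[L w w w', w'] * Lam = '[L y w y, w'] ^+ 2 + '[L y w y, J w'] ^+ 2 + 2 * '[C, C].
Proof.
move=> Lw Lw'; have [wy wJ] := N0_orth Lw.
have [v vE] : exists v, v = L w y w' by eexists.
have q1 : '[v, y] = '[L y w y, w'] by rewrite vE kop_sym.
have q2 : '[v, J y] = - '[L y w y, J w'] by rewrite vE kop_sym kopJ3 // ipJl.
have [C CE] : exists C, C = v - '[v, y] *: y - '[v, J y] *: J y by eexists.
have Cy : '[C, y] = 0 by rewrite CE !ipE ip_cplx0l y1; ring.
have CJ : '[C, J y] = 0 by rewrite CE !ipE cplx_isometry ip_cplx0 y1; ring.
have LC : N1 C.
  apply: eigen_mem => [//|/eqP //|_ t Lt].
  have [ty tJ] := N0_orth Lt.
  rewrite CE !ipE (ipC _ y) (ipC _ (J y)) ty tJ vE.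
  by rewrite (eigen_block _ y1 (N0E Lw') (N0E Lt)) mul0r; ring.
exists C.
  move=> z Lz; have [zy zJ] := N1_orth Lz.
  by rewrite CE !ipE (ipC _ y) (ipC _ (J y)) zy zJ vE; ring.
split=> //; have dE : dkop w y w' = v by rewrite dkopE N0_N0_conjmul // addr0.
have vC : v = C + '[v, y] *: y + '[v, J y] *: J y by rewrite CE; vring.
have L0 : Lam != 0 by rewrite gt_eqF.
(* The parts of [v] lie in the eigenspaces of Lam / 2 and Lam, hence the factors 2 / Lam and 1 / Lam
   inverting T_y. *)
have [u uE] : exists u, u = - ((2 / Lam) *: C + ('[v, y] / Lam) *: y + ('[v, J y] / Lam) *: J y).
  by eexists.
have Lu : L y y u = 0 *: u - dkop w y w'.
  rewrite dE scale0r sub0r uE !kopE // LC (eigenJ max_eigen) max_eigen {3}vC.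
  by apply: (@ip_inj _ _ H) => t; rewrite !ipE; field.
have := eigen_second_order_diag y1 wy (N0E Lw') Lu.
rewrite dE !mul0r subr0.
have -> : '[u, v] = - ((2 * '[C, C] + '[v, y] ^+ 2 + '[v, J y] ^+ 2) / Lam).
  have CC : '[C, v] = '[C, C] by rewrite {1}vC !ipE Cy CJ; ring.
  by rewrite uE !ipE (ipC _ y v) (ipC _ (J y) v) CC; field.
move/eqP; rewrite subr_eq0 => /eqP ->; rewrite mulfVK // q1 q2 sqrrN; ring.
Qed.

Lemma N0_sigma w : N0 w -> N0 (L y w y).
Proof. by move=> /max_sigma_ker[]. Qed.

(** For w' = sigma w the sigma terms of [N0_N0_second_order] already reach the upper bound [kop_le];
    thus [C] is 0, and equality makes sigma w a top eigenvector of T_w. *)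
Lemma N0_sigma_top w : N0 w ->
  (forall z, N1 z -> '[L w y (L y w y), z] = 0) /\
  L w w (L y w y) = (Lam * '[w, w]) *: L y w y.
Proof.
move=> Lw; have [Ls ss] := max_sigma_ker Lw.
have [C CE [LC]] := N0_N0_second_order Lw Ls.
rewrite ip_cplx0 expr0n /= addr0 => h.
have le := kop_le w (L y w y).
have hle : '[L w w (L y w y), L y w y] * Lam <= '[L y w y, L y w y] ^+ 2.
  have -> : '[L y w y, L y w y] ^+ 2 = Lam * '[w, w] * '[L y w y, L y w y] * Lam.
    by rewrite {1}expr2 {1}ss; ring.
  by rewrite ler_pM2r.
have C0 : C = 0.
  apply: (@ip_eq0 _ _ H); apply/eqP; rewrite eq_le ip_ge0 andbT.
  by move: hle; rewrite h; lra.
split; first by move=> z Lz; rewrite CE // C0 ip0l.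
apply: kop_top; apply: (mulIf (lt0r_neq0 Lam_gt0)).
by rewrite h C0 ip0l mulr0 addr0 expr2 {1}ss; ring.
Qed.

Lemma N0_sigma_isometry u w : N0 u -> N0 w -> '[L y u y, L y w y] = Lam ^+ 2 * '[u, w].
Proof.
move=> Lu Lw; have Luw : N0 (u + w) by rewrite kopD3 // Lu Lw addr0.
have [_ nu] := max_sigma_ker Lu; have [_ nw] := max_sigma_ker Lw.
have [_] := max_sigma_ker Luw.
rewrite kopD2 // !ipE (ipC _ (L y w y)) (ipC _ w u) nu nw; lra.
Qed.

(** On the kernel of T_y, sigma is symmetric and Lam times an isometry. *)
Lemma N0_sigmaK w : N0 w -> L y (L y w y) y = Lam ^+ 2 *: w.
Proof.
move=> Lw; have Ls := N0_sigma Lw; have Lss := N0_sigma Ls.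
apply/eqP; rewrite -subr_eq0; apply/eqP.
have [v vE] : exists v, v = L y (L y w y) y - Lam ^+ 2 *: w by eexists.
have Lv : N0 v by rewrite vE !kopE // Lw Lss; vring.
rewrite -vE; apply: (@ip_eq0 _ _ H).
rewrite {1}vE !ipE max_sigma_sym N0_sigma_isometry // (ipC _ v w); ring.
Qed.

(** Polarizing the first part of [N0_sigma_top] gives a sum of two terms, which J separates because
    sigma is antilinear; sigma is onto the kernel by [N0_sigmaK]. *)
Lemma N0_N0_mul_half w w' z : N0 w -> N0 w' -> N1 z -> '[L w y w', z] = 0.
Proof.
move=> Lw Lw' Lz.
have key a b t : N0 a -> N0 b -> N1 t ->
    '[L a y (L y b y), t] + '[L b y (L y a y), t] = 0.
  move=> La Lb Lt; have Lab : N0 (a + b) by rewrite kopD3 // La Lb addr0.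
  have := proj1 (N0_sigma_top Lab) _ Lt.
  rewrite kopD2 // kopD1 // !kopD3 // !ipE.
  rewrite (proj1 (N0_sigma_top La)) // (proj1 (N0_sigma_top Lb)) //; lra.
have skew a b t : N0 a -> N0 b -> N1 t -> '[L a y (L y b y), t] = 0.
  move=> La Lb Lt; have := key a b t La Lb Lt.
  have := key a (J b) (J t) La (N0J Lb) (N1J Lt).
  by rewrite !kopJ2 // kopN3 // kopJ3 // kopJ1 // !ipE !cplx_isometry; lra.
have := skew w _ z Lw (N0_sigma Lw') Lz.
rewrite N0_sigmaK // kopZ3 // ipZl => /eqP; rewrite mulf_eq0 expf_eq0 /= gt_eqF //=.
by move/eqP.
Qed.

Lemma N0_N1_conjmul w z : N0 w -> N1 z -> L y w z = 0.
Proof.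
move=> Lw Lz; apply: vec_eq0 => [||z' Lz'|w' Lw']; rewrite kop_sym.
- by rewrite kopC Lw ip0l.
- by rewrite kopJ3 // kopC Lw linear0 ip0l.
- by rewrite kopC N1_N0_mul // ip0l.
- by rewrite N0_N0_mul_half.
Qed.

(** Moving [y] towards [w] does not change T_y z to first order, so the corrector in the
    second-order identity can be 0. *)
Lemma N0_bisectional w z : N0 w -> N1 z -> '[L w w z, z] = Lam / 2 * '[w, w] * '[z, z].
Proof.
move=> Lw Lz; have [wy _] := N0_orth Lw.
have d0 : dkop w y z = 0 by rewrite dkopE N0_N1_conjmul // addr0 kopC N1_N0_mul.
have Lu : L y y 0 = Lam / 2 *: 0 - dkop w y z.
  by rewrite d0 scaler0 subr0; have := kopZ3 0 y y 0; rewrite !scale0r.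
have := eigen_second_order_diag y1 wy Lz Lu; rewrite ip0l addr0 => /eqP.
by rewrite subr_eq0 => /eqP.
Qed.

(** * The operators T_w and T_z for w in E_0(y) and z in E_{Lam/2}(y) *)

Lemma line_top_eigenspace v w : L v v w = Lam *: w ->
  (<[w]> + <[J w]> <= leigenspace (holjac v) Lam)%VS.
Proof.
move=> Lw; rewrite subv_add -!memvE.
by apply/andP; split; apply/leigenspaceP; rewrite holjacE // (eigenJ Lw).
Qed.

Lemma dim_top_eigenspace x : '[x, x] = 1 -> \dim (leigenspace (holjac x) Lam) = 2%N.
Proof.
move=> x1; rewrite (dim_eigen_holjac _ x1 y1).
apply: etrans (dim_cplx_span H (unit_neq0 y1)); congr (\dim _).
apply/eqP; rewrite eqEsubv line_top_eigenspace ?max_eigen // andbT.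
apply/subvP => v /leigenspaceP; rewrite holjacE => /max_eigenspace ->.
by rewrite memv_add // memvZ // memv_line.
Qed.

Lemma top_eigenspace x e u : '[x, x] = 1 -> e != 0 -> L x x e = Lam *: e ->
  L x x u = Lam *: u -> exists a b, u = a *: e + b *: J e.
Proof.
move=> x1 e0 Le Lu.
have E : leigenspace (holjac x) Lam = (<[e]> + <[J e]>)%VS.
  apply/esym/eqP; rewrite eqEdim line_top_eigenspace //=.
  by rewrite dim_top_eigenspace // dim_cplx_span.
have : u \in leigenspace (holjac x) Lam by apply/leigenspaceP; rewrite holjacE.
rewrite E => /memv_addP[_ /vlineP[a ->] [_ /vlineP[b ->] ->]].
by exists a, b.
Qed.

(** With e = sigma w, the line of [e] is the whole top eigenspace of T_w, so T_w <= Lam / 2 on its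
    orthogonal complement; [z] lies there and attains the bound by [N0_bisectional]. *)
Lemma N0_N1_half w z : '[w, w] = 1 -> N0 w -> N1 z -> L w w z = (Lam / 2) *: z.
Proof.
move=> w1 Lw Lz; have [e eE] : exists e, e = L y w y by eexists.
have Le : N0 e by rewrite eE; exact: N0_sigma.
have Te : L w w e = Lam *: e.
  by rewrite eE (proj2 (N0_sigma_top Lw)) w1 mulr1.
have TJe := eigenJ Te.
have e0 : e != 0.
  apply/eqP => e0; have := proj2 (max_sigma_ker Lw); rewrite -eE e0 ip0l w1 mulr1.
  by move/esym/eqP; rewrite expf_eq0 /= gt_eqF.
have ze : '[z, e] = 0 := N1_N0_orth Lz Le.
have zJe : '[z, J e] = 0 := N1_N0_orth Lz (N0J Le).
pose U v := '[v, e] = 0 /\ '[v, J e] = 0.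
have Ule v : U v -> '[L w w v, v] <= Lam / 2 * '[v, v].
  move=> [ve vJe]; apply: kop_le_of_spectrum => // a as_.
  have [->|->|->] := s_three as_; [right|by left|left].
    by move=> u /(top_eigenspace w1 e0 Te)[b [c ->]]; rewrite !ipE ve vJe !mulr0 addr0.
  by rewrite ltW // divr_gt0.
apply: (@ip_inj _ _ H) => v; rewrite ipZl.
have ee : '[e, e] != 0 by rewrite gt_eqF // ip_gt0.
have [v' v'E] : exists v', v' = v - ('[v, e] / '[e, e]) *: e - ('[v, J e] / '[e, e]) *: J e.
  by eexists.
have Uv' : U v'.
  by split; rewrite v'E !ipE ?cplx_isometry ?ip_cplx0 ?ip_cplx0l; field.
have Uz (t : R) : U (z + t *: v').
  by case: Uv' => u1 u2; split; rewrite !ipE ?u1 ?u2 ?ze ?zJe mulr0 addr0.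
have h : '[L w w z, z] = Lam / 2 * '[z, z] by rewrite N0_bisectional // w1 mulr1.
have := psd_kernel Uz Ule h.
have zTe : '[L w w z, e] = 0 by rewrite kop_adj Te ipZr ze mulr0.
have zTJe : '[L w w z, J e] = 0 by rewrite kop_adj TJe ipZr zJe mulr0.
by rewrite v'E !ipE zTe zTJe ze zJe !mulr0 !subr0.
Qed.

(** This is [N0_N1_half] read backwards through [eigen_sym]. *)
Lemma N1_N0_half z w : N1 z -> N0 w -> L z z w = (Lam / 2 * '[z, z]) *: w.
Proof.
move=> Lz Lw; have [->|w0] := eqVneq w 0.
  by rewrite scaler0; have := kopZ3 0 z z 0; rewrite !scale0r.
have [c c0 c1] := normalize_unit w0.
have Lcw : N0 (c *: w) by rewrite kopZ3 // Lw scaler0.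
have := eigen_sym c1 (N0_N1_half c1 Lcw Lz).
rewrite kopZ3 // scalerA (mulrC _ c) -(scalerA c) => E; exact: (scalerI c0 E).
Qed.

(** The norm comes from the second-order identity for the kernel vector [w] along [z]: the
    perturbation [D] lies in E_{Lam/2}, the corrector is -(2/Lam) D, and <T_z w, w> is known from
    [N1_N0_half]. *)
Lemma N1_N0_conjmul z w : N1 z -> N0 w -> N1 (L y z w) /\
  '[L y z w, L y z w] = (Lam / 2) ^+ 2 * '[z, z] * '[w, w].
Proof.
move=> Lz Lw; have [zy _] := N1_orth Lz.
have [D DE] : exists D, D = L y z w by eexists.
have LD : N1 D.
  have [wy wJ] := N0_orth Lw.
  rewrite DE; apply: eigen_mem => [_|/eqP //|_ t Lt]; last first.
    by rewrite kop_sym N1_N0_mul // ip0l.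
  split; rewrite kop_sym; first by rewrite (kopC z) Lz ipZl N1_N0_orth ?mulr0.
  by rewrite kopJ3 // (kopC z) Lz linearZ ipZl (N1_N0_orth (N1J Lz)) ?mulr0.
have L0 : Lam != 0 by rewrite gt_eqF.
have dE : dkop z y w = D by rewrite dkopE N1_N0_mul // add0r.
have Lu : L y y (- (2 / Lam) *: D) = 0 *: (- (2 / Lam) *: D) - dkop z y w.
  rewrite dE kopZ3 // LD; apply: (@ip_inj _ _ H) => t; rewrite !ipE; field.
  exact: L0.
have := eigen_second_order_diag y1 zy (N0E Lw) Lu.
rewrite dE N1_N0_half // !ipE !mul0r subr0 -DE => h; split=> //.
have -> : '[D, D] = (2 / Lam * '[D, D]) * (Lam / 2) by field.
have -> : 2 / Lam * '[D, D] = Lam / 2 * '[z, z] * '[w, w] by move: h; lra.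
by ring.
Qed.

Lemma N1_second_order z z' : N1 z -> N1 z' ->
  '[L z z z, z'] = Lam * '[z, z] * '[z, z'] - 2 / Lam * '[L z y z, L z y z'].
Proof.
move=> Lz Lz'; have [zy _] := N1_orth Lz; have L0 : Lam != 0 by rewrite gt_eqF.
have B t : N1 t -> N0 (L z y t) by exact: N1_N1_mul.
have E t : N1 t -> L y z t = (Lam / 2) *: ('[z, t] *: y + '[J z, t] *: J y).
  move=> Lt; have LE : L y y (L y z t) = Lam *: L y z t.
    apply: eigen_mem => [/eqP //|_ u Lu|_ w Lw]; rewrite kop_sym.
      have [uy uJ] := N1_orth Lu; have [_ zJ] := N1_orth Lz.
      by rewrite (eigen_block _ y1 Lu Lt) zy zJ !mul0r subrr mulr0.
    by rewrite N1_N0_mul // ip0l.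
  rewrite (max_eigenspace LE) !(kop_sym y) kopJ3 // (kopC z y y) Lz linearZ /=.
  by vring.
(* [L z y t] lies in the kernel and [L y z t] in E_Lam, at distance Lam / 2 on either side of the
   eigenvalue Lam / 2; hence the opposite signs. *)
have U t : N1 t -> let u := (2 / Lam) *: (L z y t - L y z t) in
    L y y u = (Lam / 2) *: u - dkop z y t.
  move=> Lt u; rewrite /u dkopE kopZ3 // kopD3 // kopN3 // B // E // !kopE //.
  rewrite (eigenJ max_eigen) max_eigen; apply: (@ip_inj _ _ H) => v; rewrite !ipE; field.
  exact: L0.
have := eigen_second_order y1 zy Lz (U _ Lz) Lz' (U _ Lz').
rewrite dkopE (E z) // (E z') // ip_cplx0l.
have [By BJ] := N0_orth (B _ Lz); have [By' BJ'] := N0_orth (B _ Lz').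
rewrite !ipE !(ipC _ y (L _ _ _)) !(ipC _ (J y) (L _ _ _)) By BJ By' BJ'.
rewrite cplx_isometry ip_cplx0 ip_cplx0l y1 => h.
apply/eqP; rewrite -subr_eq0 -[X in _ == X]h; apply/eqP; field.
exact: L0.
Qed.

Lemma N1_kopE z : N1 z -> N0 (L z y z) /\
  L z z z = (Lam * '[z, z]) *: z - (2 / Lam) *: L y z (L z y z).
Proof.
move=> Lz; have LB := N1_N1_mul Lz Lz; split=> //.
have [LD _] := N1_N0_conjmul Lz LB.
have [zy zJ] := N1_orth Lz; have [Dy DJ] := N1_orth LD.
have Ty : L z z y = (Lam / 2 * '[z, z]) *: y by exact: eigen_sym.
apply/eqP; rewrite -subr_eq0; apply/eqP; apply: vec_eq0 => [||t Lt|w Lw].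
- by rewrite !ipE (kop_adj z z z) Ty ipZr zy Dy; ring.
- rewrite !ipE (kop_adj z z z) kopJ3 // Ty linearZ ipZr zJ DJ.
  by ring.
- rewrite !ipE N1_second_order // (kop_adj y z) (kopC z y) -(kopC z y).
  by ring.
- rewrite !ipE (kop_adj z z z) N1_N0_half // ipZr !(N1_N0_orth _ Lw) //.
  by ring.
Qed.

Lemma N1_square_eq0 z : '[z, z] = 1 -> N1 z -> L z y z = 0.
Proof.
move=> z1 Lz; have [LB Lzz] := N1_kopE Lz; rewrite z1 mulr1 in Lzz.
have [LD DD] := N1_N0_conjmul Lz LB.
have [zy zJ] := N1_orth Lz.
have Ty : L z z y = (Lam / 2) *: y by rewrite (eigen_sym y1 Lz) z1 mulr1.
(* In E_{Lam/2}(z), which contains [y], [eigen_block] evaluates <R(v, z) y, y> in two ways, and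
   orthogonality of y to z and J z forces <z, v> = 0. *)
have z_orth v : L z z v = (Lam / 2) *: v -> '[z, v] = 0.
  move=> Lv; have := eigen_block y z1 Lv Ty; have := eigen_block v z1 Ty Ty.
  rewrite (kopC v) ip_cplx0 y1 (ipC _ y z) zy (ipC _ y (J z)) ipJl zJ => ->.
  rewrite oppr0 !mul0r mulr0 subr0 mulr1 subr0 mulr0 => /eqP.
  by rewrite mulf_eq0 gt_eqF ?divr_gt0 //= => /eqP <-; rewrite ipC.
(* So [z] has components only in E_0(z) and E_Lam(z), and T_z z lies in E_Lam(z). *)
have TT : L z z (L z z z) = Lam *: L z z z.
  apply/eqP; rewrite -subr_eq0; apply/eqP; apply: (eigen_total z1) => a v as_ Lv.
  rewrite ipDl ipNl ipZl !(kop_adj z z) Lv !(ipZr, kopZ3) // Lv ipZr.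
  have [->|aE|->] := s_three as_; last by rewrite !mul0r mulr0 subrr.
    by rewrite subrr.
  by rewrite z_orth ?mulr0 ?subrr // Lv aE.
have : '[L z z z, L z z z] = Lam * '[L z z z, z] by rewrite -kop_adj TT ipZl.
have zD : '[z, L y z (L z y z)] = '[L z y z, L z y z] by rewrite kop_adj.
have L0 : Lam != 0 by rewrite gt_eqF.
rewrite Lzz !ipE (ipC _ _ z) zD DD z1 => h.
apply: (@ip_eq0 _ _ H); set b := '[L z y z, L z y z] in h *.
(* The left side is Lam <T_z z, z> = Lam^2 - 2 b and the right side is |T_z z|^2, whence b = 0. *)
have E : Lam * (Lam - 2 / Lam * b) = Lam ^+ 2 - 3 * b.
  have E1 : Lam * (2 / Lam * b) = 2 * b by field.
  have E2 : 2 / Lam * (2 / Lam * ((Lam / 2) ^+ 2 * b)) = b by field.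
  have E3 : 2 / Lam * (Lam * b) = 2 * b by field.
  move: h; nra.
have E1 : Lam * (2 / Lam * b) = 2 * b by field.
move: E; rewrite mulrBr E1 expr2; lra.
Qed.

Lemma no_half_and_zero z w : z != 0 -> w != 0 -> N1 z -> N0 w -> False.
Proof.
move=> z0 w0 Lz Lw.
have sq u : N1 u -> L u y u = 0.
  move=> Lu; have [->|u0] := eqVneq u 0.
    by have := kopZ3 0 0 y 0; rewrite !scale0r.
  have [c c0 c1] := normalize_unit u0.
  have Lcu : N1 (c *: u) by rewrite kopZ3 // Lu !scalerA mulrC.
  have := N1_square_eq0 c1 Lcu; rewrite kopZ1 // kopZ3 // scalerA => /eqP.
  by rewrite scaler_eq0 mulf_eq0 (negbTE c0) => /eqP.
have mul0 u v : N1 u -> N1 v -> L u y v = 0.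
  move=> Lu Lv; have Luv : N1 (u + v) by rewrite kopD3 // Lu Lv scalerDr.
  have := sq _ Luv; rewrite kopD1 // !kopD3 // sq // sq // add0r addr0 (kopC v).
  move/eqP; rewrite -mulr2n -scaler_nat scaler_eq0 pnatr_eq0 => /eqP; exact.
have [LD] := N1_N0_conjmul Lz Lw.
(* R(y, z) w lies in E_{Lam/2}, so its squared norm <w, R(z, y) (R(y, z) w)> is killed by [mul0]. *)
rewrite {1}kop_adj mul0 // ip0r => E.
have : 0 < (Lam / 2) ^+ 2 * '[z, z] * '[w, w].
  by rewrite mulr_gt0 ?ip_gt0 // mulr_gt0 ?ip_gt0 // exprn_gt0 // divr_gt0.
by rewrite -E ltxx.
Qed.

End Kahler.

(** * The spectrum *)

Lemma curvature_tensor_neg (R : realType) (V : vectType R) (A : V -> V -> V -> V -> R) :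
  is_curvature_tensor A -> is_curvature_tensor (fun x y z w => - A x y z w).
Proof.
case=> A1 A2 A3 A4 As Ap Ab; split.
- by move=> y z w a u v /=; rewrite A1 /=; ring.
- by move=> x z w a u v /=; rewrite A2 /=; ring.
- by move=> x y w a u v /=; rewrite A3 /=; ring.
- by move=> x y z a u v /=; rewrite A4 /=; ring.
- by move=> x y z w; rewrite As.
- by move=> x y z w; rewrite Ap.
- by move=> x y z w; have := Ab x y z w; lra.
Qed.

(** * The model with the opposite curvature *)

Section Negation.
Variables (R : realType) (V : vectType R) (H : hermitian_model V).

Definition neg_model : hermitian_model V :=
  HermitianModel (cplx_sqr H) (cplx_isometry H) (curvature_tensor_neg (curv_tensor H)).

Lemma curv_op_neg x y : curv_op neg_model x y = - curv_op H x y.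
Proof.
apply/lfunP => z; apply: (@ip_inj _ _ H) => w.
by rewrite opp_lfunE linearNl /= curv_opP; exact: (curv_opP neg_model).
Qed.

Lemma jacobi_neg x : jacobi neg_model x = - jacobi H x.
Proof. by apply/lfunP => z; rewrite opp_lfunE !jacobiE curv_op_neg opp_lfunE. Qed.

Lemma holjac_neg x : holjac neg_model x = - holjac H x.
Proof. by rewrite /holjac !jacobi_neg -opprD. Qed.

(** [pick_unit] depends only on the inner product, which both models share. *)
Lemma complex_jacobi_neg pi : complex_jacobi neg_model pi = - complex_jacobi H pi.
Proof. exact: holjac_neg. Qed.

Lemma leigenspace_opp (f : 'End(V)) a : leigenspace (- f) a = leigenspace f (- a).
Proof.
apply/vspaceP => x; apply/leigenspaceP/leigenspaceP; rewrite opp_lfunE.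
  by move=> E; rewrite -[f x]opprK E scaleNr.
by move=> ->; rewrite scaleNr opprK.
Qed.

Lemma leigenvalue_opp (f : 'End(V)) a : leigenvalue (- f) a = leigenvalue f (- a).
Proof. by rewrite /leigenvalue leigenspace_opp. Qed.

Lemma kahler_neg : kahler H -> kahler neg_model.
Proof. by move=> hK x y; rewrite !curv_op_neg; congr (- _); exact: hK. Qed.

Lemma osserman_neg : complex_osserman H -> complex_osserman neg_model.
Proof.
case=> hJ hd; split=> [pi hpi|pi pi' hpi hpi' a].
  have /lfunP hJpi := hJ pi hpi.
  rewrite complex_jacobi_neg; apply/lfunP => x.
  have := hJpi x; rewrite !comp_lfunE !opp_lfunE linearN /= => ->.
  by [].
by rewrite !complex_jacobi_neg !leigenspace_opp; exact: hd.
Qed.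

Lemma ip_kop_neg x y z w :
  ip neg_model (kop neg_model x y z) w = - ip H (kop H x y z) w.
Proof. by rewrite !ip_kop /= opprD. Qed.

Lemma has_multiplicities_neg ms :
  has_multiplicities neg_model ms -> has_multiplicities H ms.
Proof.
case=> eigs ueigs hm; exists (map -%R eigs).
  by rewrite map_inj_uniq //; exact: oppr_inj.
move=> pi hpi; have [hv hd] := hm pi hpi; split=> [a|].
  rewrite -[a in LHS]opprK -leigenvalue_opp -complex_jacobi_neg hv.
  by rewrite -[a in RHS]opprK mem_map //; exact: oppr_inj.
rewrite -hd -map_comp; apply: eq_map => a /=.
by rewrite complex_jacobi_neg leigenspace_opp.
Qed.

End Negation.

Lemma seq_argmin (R : realFieldType) (P : pred R) (s : seq R) a : a \in s -> P a ->
  exists2 m, m \in s /\ P m & forall b, b \in s -> P b -> m <= b.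
Proof.
elim: s a => // c s IH a; rewrite inE => as_ Pa.
have [/hasP[d ds Pd]|/hasPn nP] := boolP (has P s).
  have [m [ms Pm] hm] := IH d ds Pd.
  have [/andP[Pc cm]|nc] := boolP (P c && (c <= m)).
    exists c; first by rewrite inE eqxx.
    move=> b; rewrite inE => /predU1P[->|bs] // Pb.
    by apply: le_trans (hm b bs Pb).
  exists m; first by rewrite inE ms orbT.
  move=> b; rewrite inE => /predU1P[->|bs] Pb; last exact: hm.
  by move: nc; rewrite Pb /= -ltNge => /ltW.
have ac : a = c.
  by case/predU1P: as_ => // as_; have := nP a as_; rewrite Pa.
rewrite ac in Pa; exists c; first by rewrite inE eqxx.
by move=> b; rewrite inE => /predU1P[->|bs] // Pb; have := nP b bs; rewrite Pb.
Qed.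

(* In terms of reciprocals the two hypotheses read 1/g + 1/b = - 2/M and
   1/b + 1/c = 2/L, so that 1/c > - 1/b > 1/g. *)
Lemma reflection_neg (R : realFieldType) (M g b : R) : 0 < M -> 0 < g ->
  g * (M + b) + b * (M + g) = 0 -> b < 0 /\ - g < b.
Proof.
move=> M0 g0 E; have hb : b * (M + 2 * g) = - (g * M) by lra.
have Mg : 0 < M + 2 * g by lra.
split; first by rewrite -(pmulr_llt0 _ Mg) hb oppr_lt0 mulr_gt0.
by rewrite -(ltr_pM2r Mg) hb mulNr ltrN2 mulrDr ltrDl !mulr_gt0.
Qed.

Lemma reflection_pos (R : realFieldType) (L b c : R) : 0 < L -> b < 0 ->
  b * (L - c) + c * (L - b) = 0 -> 0 < c /\ c < - b.
Proof.
move=> L0 b0 E; have hc : c * (L - 2 * b) = - b * L by lra.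
have Lb : 0 < L - 2 * b by lra.
split; first by rewrite -(pmulr_lgt0 _ Lb) hc mulr_gt0 // oppr_gt0.
by rewrite -(ltr_pM2r Lb) hc ltr_pM2l ?oppr_gt0 //; lra.
Qed.

Section MaxExists.
Variables (R : realType) (V : vectType R) (H : hermitian_model V).
Hypothesis H_kahler : kahler H.

Local Notation "''[' x , y ]" := (ip H x%R y%R) : ring_scope.
Local Notation L := (kop H).

Lemma hsc_max_exists : {:V}%VS != 0%VS -> exists2 y, '[y, y] = 1 &
  forall x, '[L x x x, x] <= '[L y y y, y] * '[x, x] ^+ 2.
Proof.
move=> V0; have [||||y _ [y1 ymax]] :=
    @quartic_max R V (ip H) (fun x y z w => '[L x y z, w]) fullv _ _ _ _ V0.
- by move=> y z w a u v /=; rewrite kopD1 // kopZ1 // ipDl ipZl.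
- by move=> x z w a u v /=; rewrite kopD2 // kopZ2 // ipDl ipZl.
- by move=> x y w a u v /=; rewrite kopD3 // kopZ3 // ipDl ipZl.
- by move=> x y z a u v /=; rewrite ipDr ipZr.
by exists y => // x; apply: ymax; exact: memvf.
Qed.

End MaxExists.

(** * Eigenvalues and multiplicities at a positive maximum *)

Section Maximum.
Variables (R : realType) (V : vectType R) (H : hermitian_model V).
Hypotheses (H_kahler : kahler H) (H_osserman : complex_osserman H).

Local Notation "''[' x , y ]" := (ip H x%R y%R) : ring_scope.
Local Notation L := (kop H).

Variable s : seq R.
Hypothesis s_iso : isospectral H s.
Variables (y : V) (Lam : R).
Hypotheses (y1 : '[y, y] = 1) (Lam_gt0 : 0 < Lam).
Hypothesis hsc_le : forall x, '[L x x x, x] <= Lam * '[x, x] ^+ 2.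
Hypothesis hsc_y : '[L y y y, y] = Lam.

Let Hn_kahler := kahler_neg H_kahler.
Let Hn_osserman := osserman_neg H_osserman.

Lemma V_neq0 : {:V}%VS != 0%VS.
Proof.
by apply: contraNneq (unit_neq0 y1) => E; rewrite -memv0 -E memvf.
Qed.

(** A negative [a] makes the maximum M for -A positive. Let g be the smallest positive eigenvalue:
    its partner at the minimum of A is some b with -g < b < 0, and the partner of b at the maximum
    is some c with 0 < c < -b < g, a contradiction. *)
Lemma eigenvalue_ge0 a : a \in s -> 0 <= a.
Proof.
move=> as_; rewrite leNgt; apply/negP => a_lt0.
have [y' y'1 hmax] := hsc_max_exists Hn_kahler V_neq0.
have [s' s'_iso] := osserman_isospectral Hn_kahler Hn_osserman y'1.
have mem_s' b : (b \in s') = (- b \in s).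
  by rewrite (proj2 (proj2 s'_iso _ y'1)) (proj2 (proj2 s_iso _ y'1)) holjac_neg leigenvalue_opp.
set M := ip _ _ _ in hmax.
have na : - a \in s' by rewrite mem_s' opprK.
have [M_le0|M_gt0] := lerP M 0.
  have naM : - a != M by apply/eqP => naM; move: M_le0 a_lt0; lra.
  by have := max_eigenvalue_le Hn_kahler s'_iso y'1 hmax erefl na naM; lra.
have [|g [gs g_gt0] gmin] := @seq_argmin _ (fun b => 0 < b) s Lam _ Lam_gt0.
  exact: (max_eigenvalue_in H_kahler s_iso y1 hsc_le hsc_y).
have ngs' : - g \in s' by rewrite mem_s' opprK.
have [||| b' b's' hb'] :=
  max_partner Hn_kahler s'_iso y'1 M_gt0 hmax erefl ngs'.
- by apply/eqP; lra.
- by apply/eqP; lra.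
- by apply/eqP; lra.
have bs : - b' \in s by rewrite -mem_s'.
have hb : g * (M + - b') + - b' * (M + g) = 0 by rewrite -[RHS]oppr0 -[in RHS]hb'; ring.
have [b_lt0 b_gt] := reflection_neg M_gt0 g_gt0 hb.
have [||| c cs hc] := max_partner H_kahler s_iso y1 Lam_gt0 hsc_le hsc_y bs.
- by rewrite lt_eqF // (lt_trans b_lt0).
- by rewrite lt_eqF.
- by rewrite lt_eqF // (lt_trans _ Lam_gt0) // pmulr_rlt0.
have [c_gt0 c_lt] := reflection_pos Lam_gt0 b_lt0 hc.
have : c < g by rewrite (lt_trans c_lt) // ltrNl.
by rewrite ltNge gmin.
Qed.

Lemma eigenvalue_three a : a \in s -> [\/ a = Lam, a = Lam / 2 | a = 0].
Proof.
move=> as_; have [->|aL] := eqVneq a Lam; first by constructor 1.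
have [->|a0] := eqVneq a 0; first by constructor 3.
have [a2|a2] := eqVneq (2 * a) Lam; first by constructor 2; lra.
have [b bs hb] := max_partner H_kahler s_iso y1 Lam_gt0 hsc_le hsc_y as_ aL a0 a2.
have a_ge0 := eigenvalue_ge0 as_; have b_ge0 := eigenvalue_ge0 bs.
have a_gt0 : 0 < a by rewrite lt_def a0.
have a_le := max_eigenvalue_le H_kahler s_iso y1 hsc_le hsc_y as_ aL.
(* The partner relation reads a Lam + b (Lam - 2 a) = 0, with the first term positive and the second
   nonnegative. *)
have : 0 < a * Lam by rewrite mulr_gt0.
have : 0 <= b * (Lam - 2 * a) by rewrite mulr_ge0 //; lra.
move: hb; lra.
Qed.

Lemma two_eigenvalues : exists2 mu, mu != Lam & forall a, a \in s -> a = Lam \/ a = mu.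
Proof.
have L2 : Lam / 2 != Lam by apply/eqP; move: Lam_gt0; lra.
have L0 : 0 != Lam by rewrite lt_eqF.
have [half|nhalf] := boolP (Lam / 2 \in s); last first.
  exists 0 => // a as_; have [->|aE|->] := eigenvalue_three as_; [by left| |by right].
  by move: nhalf; rewrite -aE as_.
exists (Lam / 2) => // a as_; have [->|->|aE] := eigenvalue_three as_; [by left|by right|].
have [z z0 Lz] := eigen_ex H_kahler s_iso y1 half.
have [w w0 Lw] := eigen_ex H_kahler s_iso y1 as_; rewrite aE scale0r in Lw.
by case: (no_half_and_zero H_kahler H_osserman s_iso y1 Lam_gt0 hsc_le hsc_y
  eigenvalue_three z0 w0 Lz Lw).
Qed.

Lemma multiplicities_of_max n : \dim {:V} = n -> (4 <= n)%N ->
  has_multiplicities H [:: (n - 2)%N; 2%N].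
Proof.
move=> dimV n4; have [mu muL hmu] := two_eigenvalues.
have dimL x : '[x, x] = 1 -> \dim (leigenspace (holjac H x) Lam) = 2%N.
  exact: (dim_top_eigenspace H_kahler H_osserman y1 Lam_gt0 hsc_le hsc_y).
have dimmu x : '[x, x] = 1 -> \dim (leigenspace (holjac H x) mu) = (n - 2)%N.
  move=> x1; rewrite -dimV -(dimL x x1); apply/esym/eqP.
  rewrite -(eqn_add2r (\dim (leigenspace (holjac H x) Lam))) subnK ?dimvS ?subvf //.
  rewrite -dimv_disjoint_sum; last first.
    apply/eqP; rewrite -subv0; apply/subvP => v; rewrite memv_cap memv0.
    move=> /andP[/leigenspaceP h1 /leigenspaceP h2].
    move/eqP: h1; rewrite h2 -subr_eq0 -scalerBl scaler_eq0 subr_eq0 eq_sym.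
    by rewrite (negbTE muL).
  rewrite eqn_leq; apply/andP; split; last by rewrite dimvS // subvf.
  apply: dimvS; apply/subvP => v _.
  have [p pE ->] := proj1 (proj2 s_iso _ x1) v.
  rewrite big_seq; apply: memv_suml => a as_.
  have pa : p a \in leigenspace (holjac H x) a by apply/leigenspaceP.
  have [aE|aE] := hmu a as_; rewrite aE in pa.
    by rewrite aE (subvP (addvSr _ _)).
  by rewrite aE (subvP (addvSl _ _)).
exists [:: mu; Lam]; first by rewrite /= inE muL.
move=> pi hpi; have [_ x1] := pick_unitP hpi.
have -> : complex_jacobi H pi = holjac H (pick_unit H pi) by [].
move: (pick_unit H pi) x1 => x x1; split; last by rewrite /= dimmu // dimL.
move=> a; rewrite !inE; apply/idP/orP => [|[/eqP->|/eqP->]].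
- rewrite -(proj2 (proj2 s_iso _ x1)) => /hmu[->|->]; [by right|by left].
(* As n >= 4, E_mu is nonzero, so the candidate [mu] is an eigenvalue. *)
- by rewrite /leigenvalue -dimv_eq0 dimmu // subn_eq0 -ltnNge (leq_trans _ n4).
- by rewrite /leigenvalue -dimv_eq0 dimL.
Qed.

End Maximum.

Lemma hsc_eq0_flat (R : realType) (V : vectType R) (H : hermitian_model V) :
  kahler H -> (forall x, ip H (kop H x x x) x = 0) -> is_flat H.
Proof.
move=> hK h0.
have diag x : kop H x x x = 0.
  have [->|x0] := eqVneq x 0.
    by have := kopZ1 H 0 0 0 0; rewrite !scale0r.
  have [c c0 c1] := normalize_unit H x0.
  (* Every unit vector now maximizes the holomorphic sectional curvature, with value 0, so
     [max_eigen] applies with Lam = 0. *)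
  have hle u : ip H (kop H u u u) u <= 0 * ip H u u ^+ 2 by rewrite h0 mul0r.
  have := max_eigen hK c1 hle (h0 _).
  rewrite scale0r kopZ1 // kopZ2 // kopZ3 // !scalerA => /eqP.
  by rewrite scaler_eq0 !mulf_eq0 (negbTE c0) => /eqP.
have cross y x : 2 *: kop H y y x + kop H y x y = 0.
  (* Comparing [diag] at y + x and y - x isolates the part linear in x, the cubic one being 0 by
     [e3]. *)
  have e1 := diag (y + x); have e2 := diag (y + - x); have e3 := diag x; have e4 := diag y.
  move: e1 e2; rewrite !kopD1 // !kopD2 // !kopD3 // !kopN1 // !kopN2 // !kopN3 //.
  rewrite e3 e4 (kopC hK x y y) (kopC hK x x y) => e1 e2.
  apply: (@ip_inj _ _ H) => w.
  have := congr1 (fun v => ip H v w) e1; have := congr1 (fun v => ip H v w) e2.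
  rewrite /= !ipE; lra.
have T0 y x : kop H y y x = 0.
  have := cross y x; have := cross y (cplx H x).
  rewrite kopJ3 // kopJ2 // => e1 e2.
  apply: (@ip_inj _ _ H) => w.
  have := congr1 (fun v => ip H v w) e2; have := congr1 (fun v => ip H v (cplx H w)) e1.
  rewrite /= !ipE !cplx_isometry; lra.
move=> x y z w.
have AJ u p q : curv H u (cplx H u) p q = 0.
  have Aq r : curv H u (cplx H u) p (cplx H r) = 0.
    have := ip_kop H u u p r; rewrite T0 // ip0l.
    have := curv_asym H u u p r; lra.
  by rewrite -[q]opprK -(cplxK H q) -linearN Aq.
(* Polarization gives A u (J v) = - A v (J u), while the Kahler symmetry gives A u (J v) = A v (J
   u). *)
have AJ2 u v p q : curv H u (cplx H v) p q = 0.
  have := AJ (u + v) p q; rewrite linearD /=.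
  have [A1 A2 _ _ _ _ _] := curv_tensor H.
  have D1 a b c : curv H (a + b) c p q = curv H a c p q + curv H b c p q.
    by have := A1 c p q 1 a b; rewrite /= scale1r mul1r.
  have D2 a b c : curv H c (a + b) p q = curv H c a p q + curv H c b p q.
    by have := A2 c p q 1 a b; rewrite /= scale1r mul1r.
  rewrite D1 !D2 !AJ; have := curvJ1 hK v u p q; have := curv_asym H (cplx H v) u p q; lra.
by rewrite -[y]opprK -(cplxK H y) -linearN AJ2.
Qed.

Local Close Scope ring_scope.

Theorem theorem1p3 (R : realType) (V : vectType R) (H : hermitian_model V)
    (n : nat) (dimV : \dim {:V} = n) (n_ge4 : (4 <= n)%N)
    (H_kahler : kahler H) (H_osserman : complex_osserman H)
    (H_nonflat : ~ is_flat H) :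
  has_multiplicities H [:: (n - 2)%N; 2] \/
  (has_multiplicities H [:: (n - 4)%N; 2; 2] /\
   exists k : nat, n = (4 * k)%N /\ (8 <= n)%N).
Proof.
left.
have V0 : {:V}%VS != 0%VS by rewrite -dimv_eq0 dimV -lt0n (leq_trans _ n_ge4).
have Hn_kahler := kahler_neg H_kahler; have Hn_osserman := osserman_neg H_osserman.
have [y y1 ymax] := hsc_max_exists H_kahler V0.
(* A positive maximum for A or for -A gives the multiplicities; if neither is positive, the
   holomorphic sectional curvature vanishes and the model is flat. *)
have [y_le0|y_gt0] := lerP (ip H (kop H y y y) y) 0%R; last first.
  have [s s_iso] := osserman_isospectral H_kahler H_osserman y1.
  exact: (multiplicities_of_max H_kahler H_osserman s_iso y1 y_gt0 ymax erefl dimV n_ge4).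
have [y' y'1 y'max] := hsc_max_exists Hn_kahler V0.
have [y'_le0|y'_gt0] := lerP (ip (neg_model H) (kop (neg_model H) y' y' y') y') 0%R; last first.
  have [s s_iso] := osserman_isospectral Hn_kahler Hn_osserman y'1.
  apply: has_multiplicities_neg.
  exact: (multiplicities_of_max Hn_kahler Hn_osserman s_iso y'1 y'_gt0 y'max erefl dimV n_ge4).
case: H_nonflat; apply: (hsc_eq0_flat H_kahler) => x.
have sq_ge0 : (0 <= ip H x x ^+ 2)%R by rewrite sqr_ge0.
have := ymax x; have := y'max x; rewrite ip_kop_neg.
have := mulr_le0_ge0 y_le0 sq_ge0; have := mulr_le0_ge0 y'_le0 sq_ge0.
move=> h1 h2 h3 h4; apply/eqP; rewrite eq_le (le_trans h4 h2) /=.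
by rewrite -oppr_le0 (le_trans h3 h1).
Qed.
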